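(* Let $\mathcal{D}=(V,E,F)$ be an infinite cellular decomposition of a non-compact surface $S$. In hyperbolic background geometry, let $\delta>0$ be arbitrarily small. Suppose $\Theta\in(\delta,\pi-\delta)^E$ satisfies condition (C1) (see context), and there exist positive constants $\hat c,\hat d$ such that for all $v_i\in V$ (1) $\bar{\mathcal{L}}_i(\mathcal{D},\Theta):=\dfrac{\sum_{j\sim i}\Theta_{ij}-2\pi}{d_i}\ge\hat c$, (2) $d_i\le\hat d$. Then for any two constants $\hat r_1,\hat r_2>0$, if the initial data $r(0)$ satisfies $\hat r_1\le r_i(0)\le\hat r_2$ for all $v_i\in V$, the solution $r(t)$ to the combinatorial Ricci flow $$\frac{\mathrm{d}r_i}{\mathrm{d}t}=-K_i\sinh r_i,\qquad\forall v_i\in V,\ t\ge0,$$ with initial value $r(0)$ is unique and converges exponentially to a good ideal circle pattern.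
   Context: $V,E,F$ are the vertices, edges and faces of $\mathcal{D}$; $j\sim i$ means $v_i,v_j$ are joined by an edge $[v_i,v_j]\in E$; $d_i$ is the degree of $v_i$; the 1-skeleton $(V,E)$ is assumed connected (graph distance between any two vertices is finite). $\Theta_{ij}=\Theta([v_i,v_j])$. Condition (C1): if edges $e_1,\dots,e_m$ form the boundary of a face, then $\sum_{l=1}^m\Theta(e_l)=(m-2)\pi$. A circle packing metric is a function $r:V\to(0,\infty)$. For an edge $[v_i,v_j]$, consider the hyperbolic triangle $v_iv_jv_f$ with $|v_iv_f|=r_i$, $|v_jv_f|=r_j$ and $|v_iv_j|=l_{ij}=\cosh^{-1}(\cosh r_i\cosh r_j+\sinh r_i\sinh r_j\cos\Theta_{ij})$; let $\theta_{ij}$ be its inner angle at $v_i$. The discrete Gaussian (vertex) curvature is $2\pi$ minus the total cone angle at $v_i$, i.e. $K_i(r)=2\pi-2\sum_{j\sim i}\theta_{ij}(r_i,r_j)$. A good ideal circle pattern is a circle packing metric $r^\infty$ with $K_i(r^\infty)=0$ for all $v_i\in V$. Exponential convergence means: there are constants $C,\gamma>0$ and a good ideal circle pattern $r^\infty$ such that $|r_i(t)-r^\infty_i|\le Ce^{-\gamma t}$ and $|K_i(r(t))|\le Ce^{-\gamma t}$ for all $v_i\in V$ and $t\ge0$. *)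

(* Defs.v *)
From HB Require Import structures.
From mathcomp Require Import all_boot all_order all_algebra.
From mathcomp Require Import finmap.
From mathcomp Require Import all_classical all_reals all_analysis.

Set Implicit Arguments.
Unset Strict Implicit.
Unset Printing Implicit Defensive.

Import Order.TTheory GRing.Theory Num.Theory.
Import numFieldNormedType.Exports.

Local Open Scope classical_set_scope.
Local Open Scope ring_scope.

Section Surfaces.
Variable R : realType.

Definition locally_euclidean_plane (S : topologicalType) : Prop :=
  forall x : S, exists (U : set S) (W : set (R * R))
    (phi : S -> R * R) (psi : R * R -> S),
    [/\ open U, U x & open W] /\
    [/\ {within U, continuous phi}, {within W, continuous psi},
        forall y, U y -> W (phi y) /\ psi (phi y) = y
      & forall p, W p -> U (psi p) /\ phi (psi p) = p].

(** Surfaces are without boundary, and need be neither orientable nor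
    compact. *)
Definition surface (S : topologicalType) : Prop :=
  [/\ hausdorff_space S, @second_countable S & locally_euclidean_plane S].

Definition closed_disk : set (R * R) :=
  [set p | p.1 ^+ 2 + p.2 ^+ 2 <= 1].

Definition open_disk : set (R * R) :=
  [set p | p.1 ^+ 2 + p.2 ^+ 2 < 1].

Definition circle_point (x : R) : R * R :=
  (cos (2 * pi * x), sin (2 * pi * x)).

(** A cellular decomposition of [S] with index types [V], [E], [F] for its
    vertices, edges and faces.  It is described by characteristic maps, which
    are only relevant on [`[0, 1]] for edges and on [closed_disk] for faces;
    their restrictions to the interiors, together with the vertices, partition
    [S].  A closed cell need not be embedded: loops, multiple edges and faces
    running several times along an edge are allowed.

    A half-edge [(e, b)] is the edge [e] with an orientation; it starts at
    [cd_end e b] and arrives at [cd_end e (~~ b)].  The boundary of a face [f]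
    is the cyclic sequence [cd_bd f] of half-edges, the [l]-th of which is run
    through by the [l]-th of [size (cd_bd f)] equal arcs of the unit circle. *)
Record cellular_decomposition (S : topologicalType) (V E F : choiceType) :=
  CellularDecomposition {
  cd_vertex : V -> S;
  cd_edge : E -> R -> S;
  cd_face : F -> R * R -> S;
  cd_end : E -> bool -> V;
  cd_bd : F -> seq (E * bool);
  cd_edge_continuous : forall e, {within `[0, 1], continuous (cd_edge e)};
  cd_face_continuous : forall f, {within closed_disk, continuous (cd_face f)};
  cd_edge0 : forall e, cd_edge e 0 = cd_vertex (cd_end e false);
  cd_edge1 : forall e, cd_edge e 1 = cd_vertex (cd_end e true);
  cd_bd_neq0 : forall f, (0 < size (cd_bd f))%N;
  cd_face_bd : forall f (l : 'I_(size (cd_bd f))) (s : R), 0 <= s <= 1 ->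
    let h := tnth (in_tuple (cd_bd f)) l in
    cd_face f (circle_point ((l%:R + s) / (size (cd_bd f))%:R)) =
    cd_edge h.1 (if h.2 then 1 - s else s);
  cd_vertex_inj : injective cd_vertex;
  cd_edge_inj : forall e e' s s', 0 < s < 1 -> 0 < s' < 1 ->
    cd_edge e s = cd_edge e' s' -> e = e' /\ s = s';
  cd_face_inj : forall f f' p p', open_disk p -> open_disk p' ->
    cd_face f p = cd_face f' p' -> f = f' /\ p = p';
  cd_vertex_edge : forall v e s, 0 < s < 1 -> cd_vertex v <> cd_edge e s;
  cd_vertex_face : forall v f p, open_disk p -> cd_vertex v <> cd_face f p;
  cd_edge_face : forall e s f p, 0 < s < 1 -> open_disk p ->
    cd_edge e s <> cd_face f p;
  cd_cover : forall x : S,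
    [\/ exists v, x = cd_vertex v,
        exists e s, 0 < s < 1 /\ x = cd_edge e s
      | exists f p, open_disk p /\ x = cd_face f p];
  cd_locally_finite : forall x : S, exists2 U, nbhs x U &
    [/\ finite_set [set v | U (cd_vertex v)],
        finite_set [set e | cd_edge e @` `[0, 1] `&` U !=set0]
      & finite_set [set f | cd_face f @` closed_disk `&` U !=set0]]
}.

End Surfaces.

Section IdealCirclePatterns.
Variables (R : realType) (S : topologicalType) (V E F : choiceType).
Variable D : cellular_decomposition R S V E F.

Definition half_edge_source (h : E * bool) : V := cd_end D h.1 h.2.
Definition half_edge_target (h : E * bool) : V := cd_end D h.1 (~~ h.2).

(** The half-edges issuing from [i]; finite by local finiteness.  All sums over
    [j ~ i] are taken over this set, which is in bijection with the neighbours
    of [i] unless the 1-skeleton has loops at [i] or multiple edges. *)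
Definition star (i : V) : set (E * bool) := [set h | half_edge_source h = i].

Definition degree (i : V) : nat := #|` fset_set (star i)|%fset.

Definition cd_adjacent (i j : V) : Prop :=
  exists2 h, star i h & half_edge_target h = j.

Definition connected_skeleton : Prop :=
  forall i j, exists p : seq V,
    path (fun x y => `[< cd_adjacent x y >]) i p /\ last i p = j.

Variable Theta : E -> R.

Definition conditionC1 : Prop :=
  forall f, \sum_(h <- cd_bd D f) Theta h.1 = ((size (cd_bd D f))%:R - 2) * pi.

Definition mean_character (i : V) : R :=
  (\sum_(h \in star i) Theta h.1 - 2 * pi) / (degree i)%:R.

End IdealCirclePatterns.

Section Hyperbolic.
Variable R : realType.
Implicit Types x y a b c theta : R.

Definition cosh x : R := (expR x + expR (- x)) / 2.
Definition sinh x : R := (expR x - expR (- x)) / 2.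

(** Inverse of [cosh] on [[1, +oo[]. *)
Definition arcosh x : R := ln (x + Num.sqrt (x ^+ 2 - 1)).

(** Inner angle between the sides of lengths [a] and [b] of a hyperbolic
    triangle whose third side has length [c]. *)
Definition hyperbolic_angle a b c : R :=
  acos ((cosh a * cosh b - cosh c) / (sinh a * sinh b)).

Definition edge_length x y theta : R :=
  arcosh (cosh x * cosh y + sinh x * sinh y * cos theta).

(** Angle at [v_i] of the triangle [v_i v_j v_f], for [x = r_i], [y = r_j]. *)
Definition inner_angle x y theta : R :=
  hyperbolic_angle x (edge_length x y theta) y.

End Hyperbolic.

Section RicciFlow.
Variables (R : realType) (S : topologicalType) (V E F : choiceType).
Variable D : cellular_decomposition R S V E F.
Variable Theta : E -> R.

Definition circle_packing_metric (r : V -> R) : Prop := forall i, 0 < r i.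

Definition curvature (r : V -> R) (i : V) : R :=
  2 * pi - 2 * \sum_(h \in star D i)
    inner_angle (r i) (r (half_edge_target D h)) (Theta h.1).

Definition good_ideal_circle_pattern (r : V -> R) : Prop :=
  circle_packing_metric r /\ forall i, curvature r i = 0.

(** [f'(t) = v] for a function on [[0, +oo[]: the derivative at [0] is
    one-sided. *)
Definition half_line_derive (f : R -> R) (t v : R) : Prop :=
  (0 < t -> is_derive t 1 f v) /\
  (t = 0 -> h^-1 * (f h - f 0) @[h --> 0^'+] --> v).

Definition ricci_flow (r0 : V -> R) (r : R -> V -> R) : Prop :=
  [/\ forall t, 0 <= t -> circle_packing_metric (r t),
      forall i, r 0 i = r0 i
    & forall i t, 0 <= t ->
        half_line_derive (fun s => r s i) t
          (- curvature (r t) i * sinh (r t i))].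

Definition converges_exponentially (r : R -> V -> R) : Prop :=
  exists (C gamma : R) (rinf : V -> R),
    [/\ 0 < C, 0 < gamma, good_ideal_circle_pattern rinf
      & forall i t, 0 <= t ->
          `|r t i - rinf i| <= C * expR (- gamma * t) /\
          `|curvature (r t) i| <= C * expR (- gamma * t)].

End RicciFlow.

(* Main.v *)
Require Import Defs.
From mathcomp Require Import all_boot all_order all_algebra.
From mathcomp Require Import finmap.
From mathcomp Require Import all_classical all_reals all_analysis.
From mathcomp Require Import ring lra.

Import Order.TTheory GRing.Theory Num.Theory.
Import numFieldNormedType.Exports.

Local Open Scope classical_set_scope.
Local Open Scope ring_scope.

Set Implicit Arguments.
Unset Strict Implicit.
Unset Printing Implicit Defensive.

(** Put [p_i = ln (coth (r_i / 2))].  In this coordinate ([dual_radius]) the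
    factor [sinh r_i] disappears and the flow reads [p_i' = K_i (p)], while the
    angles become explicit ([inner_angleE]):

      cot theta_ij = (cosh p_j + cosh p_i cos Theta_ij) / (sinh p_i sin Theta_ij).

    So [theta_ij] increases with [p_i] and decreases with [p_j], and when both
    grow at unit speed it grows at the speed
    [sin Theta (cos Theta + cosh (p_i - p_j)) / angle_den > 0].  Consequently
    [K_i] is nondecreasing in [p_j] for [j <> i], and on a box where all
    coordinates lie in [[m, M]] the decrease of [K_i] in [p_i] outweighs its
    increase in the other coordinates, with a margin that is uniform in [i] since
    [Theta] stays away from [0] and [pi].

    This has one main consequence, [flow_contraction]: two solutions that stay
    in a box approach each other exponentially fast in the sup norm.  On an
    infinite graph the sup need not be attained, so no vertex realizes the largest
    difference; instead a crude bound [N exp (- lambda t) + b exp (a t)] for the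
    difference improves itself to the same bound with [b / 2].

    Existence: clipping all coordinates to [[m, M]] makes the field bounded and
    Lipschitz for the sup norm, so Picard iteration applies ([picard]).  For
    suitable [m] and [M] the clipping is never active, by comparisons of a
    single coordinate.  When [p_i <= m] all angles at [v_i] are at most
    [pi / d_i] whatever the neighbours are, hence [K_i >= 0]
    ([exists_low_barrier]).  When [p_i = M] and all neighbours are at
    most [M], the angles at [v_i] are at least nearly [Theta_ij / 2], so that by
    the lower bound on the mean character they add up to at least [pi], hence
    [K_i <= 0] ([exists_high_barrier]).

    Uniqueness: the lower barrier also holds for an arbitrary solution, and since
    [|K_i|] is bounded such a solution stays in some box during each bounded
    time interval; there the contraction applies with [N = 0].

    Convergence: apply the contraction to [p] and its time shift.  A shift by
    [u -> 0] shows that [K_i (p (t))] decays exponentially, and a shift by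
    arbitrary times shows that [p] is Cauchy with an exponential rate. *)

(** * Hyperbolic functions *)

Section HyperbolicFunctions.
Context {R : realType}.
Implicit Types x y p q c s theta : R.

Lemma sqr_cosh x : cosh x ^+ 2 = 1 + sinh x ^+ 2.
Proof.
have e : expR x * expR (- x) = 1 by rewrite -expRD subrr expR0.
rewrite /cosh /sinh.
have -> : ((expR x + expR (- x)) / 2) ^+ 2 =
  expR x * expR (- x) + ((expR x - expR (- x)) / 2) ^+ 2 by field.
by rewrite e.
Qed.

Lemma cosh_ge1 x : 1 <= cosh x.
Proof.
have e : expR x * expR (- x) = 1 by rewrite -expRD subrr expR0.
rewrite /cosh ler_pdivlMr//.
have := sqr_ge0 (expR x - expR (- x)); have := expR_gt0 x; have := expR_gt0 (- x).
set a := expR x in e *; set b := expR (- x) in e *; nra.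
Qed.

Lemma sinh_gt0 x : 0 < x -> 0 < sinh x.
Proof. by move=> x0; rewrite /sinh divr_gt0// subr_gt0 ltr_expR; lra. Qed.

Lemma sinh_ge0 x : 0 <= x -> 0 <= sinh x.
Proof. by move=> x0; rewrite /sinh divr_ge0// subr_ge0 ler_expR; lra. Qed.

Lemma ler_sinh x y : x <= y -> sinh x <= sinh y.
Proof.
move=> xy; rewrite /sinh.
have := xy; rewrite -ler_expR => h1.
have : expR (- y) <= expR (- x) by rewrite ler_expR; lra.
lra.
Qed.

Lemma ler_cosh x y : 0 <= x -> x <= y -> cosh x <= cosh y.
Proof.
move=> x0 xy.
have sx := sinh_ge0 x0; have sxy := ler_sinh xy.
have cx := cosh_ge1 x; have cy := cosh_ge1 y.
rewrite -(ler_pXn2r (n := 2))// ?nnegrE; [|lra..].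
by rewrite !sqr_cosh lerD2l ler_pXn2r// nnegrE; lra.
Qed.

Lemma coshB x y : cosh (x - y) = cosh x * cosh y - sinh x * sinh y.
Proof.
by rewrite /cosh /sinh opprB !expRD; field.
Qed.

Lemma is_derive_cosh x : is_derive x 1 (@cosh R) (sinh x).
Proof.
rewrite /cosh /sinh.
have -> : (fun x : R => (expR x + expR (- x)) / 2) =
  2^-1 *: (@expR R + (@expR R \o -%R)).
  by apply/funext => z /=; rewrite fctE /GRing.scale/= mulrC.
apply: is_derive_eq.
by rewrite /GRing.scale/=; lra.
Qed.

Lemma is_derive_sinh x : is_derive x 1 (@sinh R) (cosh x).
Proof.
rewrite /cosh /sinh.
have -> : (fun x : R => (expR x - expR (- x)) / 2) =
  2^-1 *: (@expR R - (@expR R \o -%R)).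
  by apply/funext => z /=; rewrite fctE /GRing.scale/= mulrC.
apply: is_derive_eq.
by rewrite /GRing.scale/=; lra.
Qed.

Lemma ltr_sinh x y : x < y -> sinh x < sinh y.
Proof.
move=> xy; rewrite /sinh.
have := xy; rewrite -ltr_expR => h1.
have : expR (- y) < expR (- x) by rewrite ltr_expR; lra.
lra.
Qed.

Lemma cosh_gt_sinh x : sinh x < cosh x.
Proof. by rewrite /cosh /sinh; have := expR_gt0 (- x); lra. Qed.

Lemma cosh_arcosh x : 1 <= x -> cosh (arcosh x) = x.
Proof.
move=> x1; rewrite /cosh /arcosh.
have s0 : 0 <= Num.sqrt (x ^+ 2 - 1) by exact: sqrtr_ge0.
have e : Num.sqrt (x ^+ 2 - 1) ^+ 2 = x ^+ 2 - 1 by rewrite sqr_sqrtr//; nra.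
set z := Num.sqrt _ in s0 e *.
rewrite expRN lnK ?posrE; last by lra.
have h : x + z != 0 by apply: lt0r_neq0; lra.
apply: (mulfI h).
rewrite mulrA mulrDr mulfV//.
have -> : (x + z) * (x + z) = x ^+ 2 + z ^+ 2 + 2 * x * z by ring.
by rewrite e; field.
Qed.

Lemma sinh_arcosh x : 1 <= x -> sinh (arcosh x) = Num.sqrt (x ^+ 2 - 1).
Proof.
move=> x1; rewrite /sinh /arcosh.
have s0 : 0 <= Num.sqrt (x ^+ 2 - 1) by exact: sqrtr_ge0.
have e : Num.sqrt (x ^+ 2 - 1) ^+ 2 = x ^+ 2 - 1 by rewrite sqr_sqrtr//; nra.
set z := Num.sqrt _ in s0 e *.
rewrite expRN lnK ?posrE; last by lra.
have h : x + z != 0 by apply: lt0r_neq0; lra.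
apply: (mulfI h).
rewrite mulrA mulrBr mulfV//.
have -> : (x + z) * (x + z) = x ^+ 2 + z ^+ 2 + 2 * x * z by ring.
have -> : (x + z) * z = x * z + z ^+ 2 by ring.
by rewrite e; field.
Qed.

End HyperbolicFunctions.

(** * The dual radius and the angles in terms of it *)

Section DualRadius.
Context {R : realType}.
Implicit Types x y p q theta : R.

(** This is [ln (coth (x / 2))]; the map is an involution that exchanges [sinh]
    with [1 / sinh] and [cosh] with [coth]. *)
Definition dual_radius x : R := ln ((cosh x + 1) / sinh x).

Lemma expR_dual_radius x : 0 < x ->
  expR (dual_radius x) = (cosh x + 1) / sinh x.
Proof.
move=> x0; rewrite lnK// posrE divr_gt0 ?sinh_gt0//.
by have := cosh_ge1 x; lra.
Qed.

Lemma sinh_dual_radius x : 0 < x -> sinh (dual_radius x) = (sinh x)^-1.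
Proof.
move=> x0; rewrite {1}/sinh expRN expR_dual_radius//.
have s0 := sinh_gt0 x0; have c1 := cosh_ge1 x.
have e : cosh x ^+ 2 - sinh x ^+ 2 = 1 by rewrite sqr_cosh; ring.
have h1 : sinh x != 0 by lra.
have h2 : cosh x + 1 != 0 by lra.
have -> : (cosh x + 1) / sinh x - ((cosh x + 1) / sinh x)^-1 =
  (cosh x ^+ 2 - sinh x ^+ 2 + 2 * cosh x + 1) / ((cosh x + 1) * sinh x).
  by field; rewrite h1 h2.
by rewrite e; field; rewrite h1 h2.
Qed.

Lemma cosh_dual_radius x : 0 < x -> cosh (dual_radius x) = cosh x / sinh x.
Proof.
move=> x0; have e := sinh_dual_radius x0.
rewrite {1}/sinh expR_dual_radius// in e; rewrite {1}/cosh expR_dual_radius//.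
have s0 := sinh_gt0 x0.
have -> : expR (- dual_radius x) = (cosh x + 1) / sinh x - 2 * (sinh x)^-1.
  lra.
by field; lra.
Qed.

Lemma dual_radius_gt0 x : 0 < x -> 0 < dual_radius x.
Proof.
move=> x0; rewrite ltNge; apply/negP => /ler_sinh.
rewrite sinh_dual_radius// /(sinh 0) oppr0 subrr mul0r.
by rewrite leNgt invr_gt0 sinh_gt0.
Qed.

Lemma dual_radiusK x : 0 < x -> dual_radius (dual_radius x) = x.
Proof.
move=> x0; rewrite {1}/dual_radius sinh_dual_radius// cosh_dual_radius//.
have s0 := sinh_gt0 x0.
have -> : (cosh x / sinh x + 1) / (sinh x)^-1 = expR x.
  have -> : expR x = cosh x + sinh x by rewrite /cosh /sinh; field.
  by field; lra.
exact: expRK.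
Qed.

Lemma ler_dual_radius x y : 0 < x -> x <= y -> dual_radius y <= dual_radius x.
Proof.
move=> x0 xy; have y0 : 0 < y by lra.
rewrite leNgt; apply/negP => /ltr_sinh; rewrite !sinh_dual_radius// ltNge.
rewrite lef_pV2 ?posrE ?sinh_gt0//.
by rewrite ler_sinh.
Qed.

(** The derivative cancels the factor [sinh r_i] of the Ricci flow. *)
Lemma is_derive_dual_radius x : 0 < x ->
  is_derive x 1 dual_radius (- (sinh x)^-1).
Proof.
move=> x0; have s0 := sinh_gt0 x0; have c1 := cosh_ge1 x.
have h1 : sinh x != 0 by lra.
have h2 : cosh x + 1 != 0 by lra.
have h3 : 0 < (cosh x + 1) / sinh x by rewrite divr_gt0//; lra.
have dc := @is_derive_cosh R x; have ds := @is_derive_sinh R x.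
have dn : is_derive x 1 (@cosh R + cst 1) (sinh x).
  by apply: is_derive_eq; rewrite addr0.
have dv : is_derive x 1 (fun z : R => (sinh z)^-1) (- (sinh x) ^- 2 *: cosh x).
  exact: is_deriveV.
have dq : is_derive x 1 (fun z : R => (cosh z + 1) / sinh z) (- ((cosh x + 1) / sinh x ^+ 2)).
  have := is_deriveM dn dv.
  rewrite (_ : (@cosh R + cst 1) * _ = (fun z : R => (cosh z + 1) / sinh z)) //.
  move=> h; apply: (@is_derive_eq _ _ _ _ _ _ _ _ h).
  rewrite /GRing.scale /= !fctE /=.
  have e : sinh x ^+ 2 = cosh x ^+ 2 - 1 by rewrite sqr_cosh; ring.
  have h4 : cosh x ^+ 2 - 1 != 0 by rewrite -e expf_neq0.
  rewrite mulVf//.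
  by rewrite e; field.
have dl : is_derive ((cosh x + 1) / sinh x) 1 (@ln R) ((cosh x + 1) / sinh x)^-1.
  exact: is_derive1_ln.
have := @is_derive1_comp _ (@ln R) (fun z : R => (cosh z + 1) / sinh z) x _ _ dl dq.
move=> h; apply: (@is_derive_eq _ _ _ _ _ _ _ _ h).
by field; rewrite h1 h2.
Qed.

(** [pi / 2 - atan z] is the arc cotangent of [z] with values in [[0, pi]], and
    the cotangent here is the one that the four-part formula gives for a triangle
    with angle [pi - theta] between the sides dual to [p] and [q]. *)
Definition ideal_angle theta p q : R :=
  pi / 2 - atan ((cosh q + cosh p * cos theta) / (sinh p * sin theta)).

(** With [N = sinh x cosh y + cosh x sinh y cos theta] and [T = sinh y sin theta],
    the length [l] of the edge satisfies [sinh l ^ 2 = N ^ 2 + T ^ 2], and the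
    cosine of the angle is [N / sinh l]; so its cotangent is [N / T]. *)
Lemma inner_angleE x y theta : 0 < x -> 0 < y -> 0 < sin theta ->
  inner_angle x y theta = ideal_angle theta (dual_radius x) (dual_radius y).
Proof.
move=> x0 y0 s0; rewrite /inner_angle /hyperbolic_angle /ideal_angle /edge_length.
rewrite !cosh_dual_radius// !sinh_dual_radius//.
have sx := sinh_gt0 x0; have sy := sinh_gt0 y0.
set L := cosh x * cosh y + _.
set N := sinh x * cosh y + cosh x * sinh y * cos theta.
set T := sinh y * sin theta.
have T0 : 0 < T by rewrite mulr_gt0.
have L1 : 1 <= L.
  apply: (le_trans (cosh_ge1 (x - y))); rewrite coshB lerD2l.
  have := cos_geN1 theta; have := mulr_gt0 sx sy.
  by set a := sinh x * sinh y; nra.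
have cs : cos theta ^+ 2 = 1 - sin theta ^+ 2 by rewrite -(cos2Dsin2 theta); ring.
have eL : L ^+ 2 - 1 = N ^+ 2 + T ^+ 2.
  apply/eqP; rewrite -subr_eq0; apply/eqP.
  transitivity ((cosh x ^+ 2 - sinh x ^+ 2) * (cosh y ^+ 2 - sinh y ^+ 2 * cos theta ^+ 2)
    - 1 - sinh y ^+ 2 * sin theta ^+ 2); first by rewrite /L /N /T; ring.
  by rewrite cs !sqr_cosh; ring.
rewrite cosh_arcosh// sinh_arcosh// eL.
have W0 : 0 < Num.sqrt (N ^+ 2 + T ^+ 2) by rewrite sqrtr_gt0; nra.
have -> : (cosh x * L - cosh y) / (sinh x * Num.sqrt (N ^+ 2 + T ^+ 2)) =
  N / Num.sqrt (N ^+ 2 + T ^+ 2).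
  have -> : cosh x * L - cosh y = sinh x * N.
    transitivity (cosh x ^+ 2 * cosh y - cosh y + cosh x * sinh x * sinh y * cos theta).
      by rewrite /L; ring.
    by rewrite sqr_cosh /N; ring.
  by field; apply/andP; split; lra.
have -> : (cosh y / sinh y + cosh x / sinh x * cos theta) / ((sinh x)^-1 * sin theta) = N / T.
  by rewrite /N /T; field; rewrite !lt0r_neq0.
have -> : N / Num.sqrt (N ^+ 2 + T ^+ 2) = cos (pi / 2 - atan (N / T)).
  set z := N / T.
  rewrite -cosN opprB cosBpihalf -[sin _]mulr1 -(mulVf (x := cos (atan z))); last first.
    by rewrite gt_eqF// cos_gt0_pihalf// atan_gtNpi2 atan_ltpi2.
  rewrite mulrA -/(tan (atan z)) atanK cos_atan.
  have -> : N ^+ 2 + T ^+ 2 = T ^+ 2 * (1 + z ^+ 2) by rewrite /z; field; lra.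
  rewrite sqrtrM ?sqr_ge0// sqrtr_sqr gtr0_norm// /z.
  have : 0 < Num.sqrt (1 + (N / T) ^+ 2) by rewrite sqrtr_gt0; nra.
  by move=> ?; field; rewrite !lt0r_neq0.
rewrite cosK// in_itv/=.
have := atan_gtNpi2 (N / T); have := atan_ltpi2 (N / T); lra.
Qed.

End DualRadius.

(** * Variation of the angles *)

Section AngleVariation.
Context {R : realType}.
Implicit Types p q theta sigma kappa m M : R.

(** The numerator of [1 + cot ^ 2] of the angle.  It is symmetric in [p] and
    [q] by [angle_denE], so the two partial derivatives below have a common
    denominator and their sum is
    [sin theta (cos theta + cosh (p - q)) / angle_den]. *)
Definition angle_den theta p q : R :=
  (cosh q + cos theta * cosh p) ^+ 2 + (sin theta * sinh p) ^+ 2.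

Definition angle_dp theta p q : R :=
  sin theta * (cos theta + cosh p * cosh q) / angle_den theta p q.

Definition angle_dq theta p q : R :=
  - (sin theta * (sinh p * sinh q) / angle_den theta p q).

Lemma angle_den_gt0 theta p q : 0 < p -> 0 < sin theta ->
  0 < angle_den theta p q.
Proof.
move=> p0 s0; rewrite ltr_wpDl ?sqr_ge0// exprn_gt0// mulr_gt0//.
exact: sinh_gt0.
Qed.

Lemma angle_denE theta p q : angle_den theta p q =
  cosh p ^+ 2 + cosh q ^+ 2 + 2 * cos theta * (cosh p * cosh q) - sin theta ^+ 2.
Proof.
rewrite /angle_den.
transitivity (cosh q ^+ 2 + 2 * cos theta * (cosh p * cosh q) +
  cos theta ^+ 2 * cosh p ^+ 2 + sin theta ^+ 2 * sinh p ^+ 2); first by ring.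
have -> : cos theta ^+ 2 = 1 - sin theta ^+ 2 by rewrite -(cos2Dsin2 theta); ring.
by rewrite (sqr_cosh p); ring.
Qed.

Lemma is_derive_affine (a b t : R) : is_derive t 1 (fun u => a + u * b) b.
Proof.
have -> : (fun u => a + u * b) = cst a + b \*: id.
  by apply/funext => u; congr (_ + _); exact: mulrC.
apply: (is_derive_eq (is_deriveD (is_derive_cst _ _ _)
  (is_deriveZ _ (is_derive_id _ _)))).
by rewrite add0r /GRing.scale/= mulr1.
Qed.

Lemma is_derive_ideal_angle theta (x y : R -> R) (t dx dy : R) :
  is_derive t 1 x dx -> is_derive t 1 y dy -> 0 < x t -> 0 < sin theta ->
  is_derive t 1 (fun u => ideal_angle theta (x u) (y u))
    (angle_dp theta (x t) (y t) * dx + angle_dq theta (x t) (y t) * dy).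
Proof.
move=> hx hy x0 s0; have sx := sinh_gt0 x0.
have hcx := @is_derive1_comp _ (@cosh R) x t _ _ (is_derive_cosh (x t)) hx.
have hcy := @is_derive1_comp _ (@cosh R) y t _ _ (is_derive_cosh (y t)) hy.
have hsx := @is_derive1_comp _ (@sinh R) x t _ _ (is_derive_sinh (x t)) hx.
set c := cos theta; set s := sin theta.
have hn : is_derive t 1 (fun u => cosh (y u) + cosh (x u) * c)
    (sinh (y t) * dy + c * (sinh (x t) * dx)).
  have -> : (fun u => cosh (y u) + cosh (x u) * c) =
      (@cosh R \o y) + c *: (@cosh R \o x).
    by apply/funext => u; congr (_ + _); exact: mulrC.
  exact: (is_deriveD hcy (is_deriveZ c hcx)).
have hd0 : is_derive t 1 (fun u => sinh (x u) * s) (s * (cosh (x t) * dx)).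
  have -> : (fun u => sinh (x u) * s) = s *: (@sinh R \o x).
    by apply/funext => u; exact: mulrC.
  exact: (is_deriveZ s hsx).
have d0 : sinh (x t) * s != 0 by rewrite mulf_neq0// gt_eqF.
have hd : is_derive t 1 (fun u => (sinh (x u) * s)^-1)
    (- (sinh (x t) * s) ^- 2 *: (s * (cosh (x t) * dx))) by exact: is_deriveV.
have hq := is_deriveM hn hd.
have ha := @is_derive1_comp _ (@atan R)
  (fun u => (cosh (y u) + cosh (x u) * c) / (sinh (x u) * s)) t _ _
  (is_derive1_atan _) hq.
have hc : is_derive t 1 (cst (pi / 2) : R -> R) 0 by exact: is_derive_cst.
have := is_deriveB hc ha.
move=> h; apply: (@is_derive_eq _ _ _ _ _ _ _ _ h).
rewrite /GRing.scale /= /angle_dp /angle_dq -/c -/s.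
have D0 := angle_den_gt0 (y t) x0 s0.
have eD : 1 + ((cosh (y t) + cosh (x t) * c) / (sinh (x t) * s)) ^+ 2 =
    angle_den theta (x t) (y t) / (sinh (x t) * s) ^+ 2.
  by rewrite /angle_den -/c -/s; field; rewrite !gt_eqF.
rewrite eD.
have h1 : sinh (x t) != 0 by rewrite gt_eqF.
have h2 : s != 0 by rewrite gt_eqF.
have h3 : angle_den theta (x t) (y t) != 0 by rewrite gt_eqF.
set D := angle_den _ _ _ in h3 *.
have e2 : cosh (x t) ^+ 2 = 1 + sinh (x t) ^+ 2 by exact: sqr_cosh.
rewrite sub0r.
set cy := cosh (y t); set sy := sinh (y t).
set cx := cosh (x t) in e2 *; set sx' := sinh (x t) in h1 e2 *.
transitivity (- (s * (sx' * (sy * dy + c * (sx' * dx)) - (cy + cx * c) * (cx * dx))) / D).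
  by field; rewrite h1 h2 h3.
transitivity (- (s * (sx' * sy * dy - (cy * cx + c * (cx ^+ 2 - sx' ^+ 2)) * dx)) / D).
  by congr (- (s * _) / D); ring.
by rewrite e2; field.
Qed.

(** Bounds on a box [[m, M]]: from below for the derivative in the direction
    [(1, 1)], from above for the one in the direction of [p]. *)
Definition angle_contraction sigma kappa M : R := sigma * kappa / (4 * cosh M ^+ 2).
Definition angle_lipschitz sigma m M : R :=
  2 * cosh M ^+ 2 / (sigma * sinh m) ^+ 2.

Lemma angle_gradient_bounds theta sigma kappa m M p q :
  0 < sigma <= sin theta -> 0 < kappa <= 1 + cos theta ->
  0 < m -> m <= p <= M -> m <= q <= M ->
  [/\ angle_dq theta p q <= 0,
      angle_contraction sigma kappa M <= angle_dp theta p q + angle_dq theta p q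
    & angle_dp theta p q <= angle_lipschitz sigma m M].
Proof.
move=> /andP[sg0 sgs] /andP[k0 kk] m0 /andP[mp pM] /andP[mq qM].
have p0 : 0 < p by lra.
have q0 : 0 < q by lra.
have s0 : 0 < sin theta by lra.
have D0 := angle_den_gt0 q p0 s0.
have sm := sinh_gt0 m0.
have smp := ler_sinh mp; have smq := ler_sinh mq.
have cp1 := cosh_ge1 p; have cq1 := cosh_ge1 q.
have cpM := ler_cosh (ltW p0) pM; have cqM := ler_cosh (ltW q0) qM.
have s1 := sin_le1 theta; have c1 := cos_le1 theta.
have cc0 : 0 <= cosh p * cosh q by rewrite mulr_ge0; lra.
have ccM : cosh p * cosh q <= cosh M ^+ 2 by rewrite expr2 ler_pM; lra.
have DM : angle_den theta p q <= 4 * cosh M ^+ 2.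
  rewrite angle_denE.
  have : cosh p ^+ 2 <= cosh M ^+ 2 by rewrite ler_pXn2r// nnegrE; lra.
  have : cosh q ^+ 2 <= cosh M ^+ 2 by rewrite ler_pXn2r// nnegrE; lra.
  have := sqr_ge0 (sin theta).
  have : cos theta * (cosh p * cosh q) <= 1 * (cosh p * cosh q) by rewrite ler_wpM2r.
  rewrite -mulrA; lra.
have Dm : (sigma * sinh m) ^+ 2 <= angle_den theta p q.
  have h0 : 0 <= sigma * sinh m by exact: ltW (mulr_gt0 sg0 sm).
  have h1 : sigma * sinh m <= sin theta * sinh p.
    exact: ler_pM (ltW sg0) (ltW sm) sgs smp.
  by rewrite /angle_den ler_wpDl ?sqr_ge0// ler_pXn2r ?nnegrE//; lra.
split.
- rewrite /angle_dq oppr_le0; apply: divr_ge0; last exact: ltW.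
  by apply: mulr_ge0; [lra | apply: mulr_ge0; lra].
- rewrite /angle_contraction /angle_dp /angle_dq -mulNr -mulrDl -mulrN -mulrDr -addrA -coshB.
  have cpq := cosh_ge1 (p - q).
  have k1 : sigma * kappa <= sin theta * (cos theta + cosh (p - q)).
    by apply: ler_pM; lra.
  apply: ler_pM k1 _.
  + by apply: mulr_ge0; lra.
  + by rewrite invr_ge0; lra.
  + by rewrite lef_pV2 ?posrE//; lra.
- have cc1 : 1 * 1 <= cosh p * cosh q by apply: ler_pM.
  have cg := cos_geN1 theta.
  have t0 : 0 <= cos theta + cosh p * cosh q by lra.
  rewrite /angle_dp /angle_lipschitz; apply: ler_pM.
  + by apply: mulr_ge0 => //; lra.
  + by rewrite invr_ge0; lra.
  + by have := ler_wpM2r t0 s1; lra.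
  + by rewrite lef_pV2 ?posrE// exprn_gt0// mulr_gt0.
Qed.

(** The mean value theorem is applied along the segment from [(p', q')] to
    [(p, q)] and not coordinate by coordinate, because the lower bound on [P + Q]
    holds only for the two partial derivatives at a common point. *)
Lemma ideal_angle_increment theta sigma kappa m M p q p' q' :
  0 < sigma <= sin theta -> 0 < kappa <= 1 + cos theta ->
  0 < m -> m <= p <= M -> m <= q <= M -> m <= p' <= M -> m <= q' <= M ->
  exists P Q : R,
    [/\ ideal_angle theta p q - ideal_angle theta p' q' =
          P * (p - p') + Q * (q - q'),
        Q <= 0, angle_contraction sigma kappa M <= P + Q
      & P <= angle_lipschitz sigma m M].
Proof.
move=> hs hk m0 hp hq hp' hq'.
pose x (u : R) := p' + u * (p - p'); pose y (u : R) := q' + u * (q - q').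
have hx (u : R) : is_derive u 1 x (p - p') by exact: is_derive_affine.
have hy (u : R) : is_derive u 1 y (q - q') by exact: is_derive_affine.
have xb (u : R) : 0 <= u <= 1 -> m <= x u <= M by rewrite /x; nra.
have yb (u : R) : 0 <= u <= 1 -> m <= y u <= M by rewrite /y; nra.
have s0 : 0 < sin theta by lra.
have dg (u : R) : 0 <= u <= 1 ->
    is_derive u 1 (fun z => ideal_angle theta (x z) (y z))
    (angle_dp theta (x u) (y u) * (p - p') + angle_dq theta (x u) (y u) * (q - q')).
  move=> hu; apply: is_derive_ideal_angle => //.
  by have := xb _ hu; lra.
have [| |u /[!in_itv]/= hu] := @MVT _ (fun z => ideal_angle theta (x z) (y z))
    (fun u => angle_dp theta (x u) (y u) * (p - p') +
              angle_dq theta (x u) (y u) * (q - q')) 0 1 ltr01.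
- by move=> u; rewrite in_itv/= => hu; apply: dg; lra.
- apply: derivable_within_continuous => u; rewrite in_itv/= => hu.
  by have [] := dg _ hu.
have hu' : 0 <= u <= 1 by lra.
rewrite {1 2}/x {1 2}/y !mul0r !addr0 !mul1r subr0 mulr1.
rewrite (addrC p') subrK (addrC q') subrK => ->.
have [h1 h2 h3] := angle_gradient_bounds hs hk m0 (xb _ hu') (yb _ hu').
by exists (angle_dp theta (x u) (y u)), (angle_dq theta (x u) (y u)).
Qed.

End AngleVariation.

(** * Extreme values of the angles *)

Section AngleBarriers.
Context {R : realType}.
Implicit Types p q theta sigma kappa m M : R.

Lemma tan_pihalfB (a : R) : tan (pi / 2 - a) = cos a / sin a.
Proof.
rewrite /tan -[in cos _]cosN opprB cosBpihalf -[in sin _]opprB sinN sinBpihalf.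
by rewrite opprK.
Qed.

Lemma ler_atanB (x y : R) : x <= y -> atan y - atan x <= y - x.
Proof.
rewrite le_eqVlt => /predU1P[->|xy]; first by rewrite !subrr.
have [|c _ ->] := @MVT _ (@atan R) (fun z => (1 + z ^+ 2)^-1) x y xy.
  by apply: derivable_within_continuous => z _; exact: derivable_atan.
rewrite -[leRHS]mul1r ler_wpM2r ?subr_ge0 ?(ltW xy)//.
by rewrite invf_le1 ?lerDl ?sqr_ge0// ltr_pwDl// sqr_ge0.
Qed.

(** As [p] tends to [0], the cotangent is at least
    [(1 + cos theta cosh p) / sinh p], which tends to infinity whatever [q] is. *)
Lemma ideal_angle_small (kappa alpha : R) : 0 < kappa -> 0 < alpha ->
  exists2 m : R, 0 < m & forall theta p q, 0 < sin theta ->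
    kappa <= 1 + cos theta -> 0 < p <= m -> ideal_angle theta p q <= alpha.
Proof.
move=> k0 a0.
have p2 : 0 < pi / 2 :> R by rewrite divr_gt0// pi_gt0.
pose b := Num.min alpha (pi / 2).
have b0 : 0 < b by rewrite lt_min a0.
have bp : b <= pi / 2 by rewrite ge_min lexx orbT.
have ba : b <= alpha by rewrite ge_min lexx.
pose Z := `|tan (pi / 2 - b)|.
have Z0 : 0 <= Z by exact: normr_ge0.
have aZ : pi / 2 - b <= atan Z.
  rewrite -[leLHS]tanK ?in_itv/=; last by lra.
  by apply: le_atan; exact: ler_norm.
pose e := Num.min 1 (kappa / (2 * (Z + 1))).
have e1 : e <= 1 by rewrite ge_min lexx.
have ek : e * (2 * (Z + 1)) <= kappa.
  by rewrite -ler_pdivlMr ?ge_min ?lexx ?orbT//; lra.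
have e0 : 0 < e by rewrite lt_min ltr01 divr_gt0//; lra.
(* so that sinh m = e for m = arcosh L *)
pose L := Num.sqrt (1 + e ^+ 2).
have L1 : 1 <= L by rewrite -[leLHS]sqrtr1 ler_wsqrtr// lerDl sqr_ge0.
have sL : sinh (arcosh L) = e.
  rewrite sinh_arcosh// sqr_sqrtr ?addr_ge0 ?sqr_ge0//.
  by rewrite addrAC subrr add0r sqrtr_sqr gtr0_norm.
exists (arcosh L).
  rewrite ltNge; apply/negP => /ler_sinh; rewrite sL.
  by rewrite {1}/sinh oppr0 subrr mul0r; lra.
move=> theta p q s0 kc /andP[p0 pm].
rewrite /ideal_angle.
suff ZC : Z <= (cosh q + cosh p * cos theta) / (sinh p * sin theta).
  by have := le_atan ZC; lra.
have sp0 := sinh_gt0 p0; have spe := ler_sinh pm; rewrite sL in spe.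
have s1 := sin_le1 theta; have c1 := cos_geN1 theta; have c2 := cos_le1 theta.
rewrite (ler_pdivlMr _ _ (mulr_gt0 sp0 s0)).
have cp1 := cosh_ge1 p; have cq1 := cosh_ge1 q.
have cp2 : cosh p <= 1 + kappa / 2.
  have := sqr_cosh p; have : sinh p ^+ 2 <= e ^+ 2 by rewrite ler_pXn2r ?nnegrE//; lra.
  nra.
have num : kappa / 2 <= cosh q + cosh p * cos theta by nra.
apply: le_trans num.
have h : sinh p * sin theta <= e * 1 by apply: ler_pM; lra.
have : Z * (sinh p * sin theta) <= Z * e by rewrite ler_wpM2l//; lra.
nra.
Qed.

Lemma half_angleE theta : 0 < theta < pi ->
  theta / 2 = pi / 2 - atan ((1 + cos theta) / sin theta).
Proof.
move=> /andP[t0 tp]; set h := theta / 2.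
have hE : theta = h + h by rewrite /h; field.
have s0 : 0 < sin h by apply: sin_gt0_pihalf; rewrite /h; lra.
have c0 : 0 < cos h by apply: cos_gt0_pihalf; rewrite /h; lra.
have -> : (1 + cos theta) / sin theta = tan (pi / 2 - h).
  rewrite tan_pihalfB hE cosD sinD.
  have -> : 1 + (cos h * cos h - sin h * sin h) = 2 * cos h ^+ 2.
    by have := cos2Dsin2 h; rewrite !expr2; lra.
  have -> : sin h * cos h + cos h * sin h = 2 * (sin h * cos h) by ring.
  by field; rewrite !lt0r_neq0.
rewrite tanK; first by ring.
by rewrite in_itv/= /h; lra.
Qed.

(** For equal sides the triangle is isosceles, and the cotangent of its base angle
    is [coth M cot (theta / 2)].  So the angle tends to [theta / 2], uniformly in
    [theta] since [cot (theta / 2) <= 2 / sigma] and the arc cotangent is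
    1-Lipschitz. *)
Lemma ideal_angle_diag_lower (sigma eps : R) : 0 < sigma -> 0 < eps ->
  exists2 M0 : R, 0 < M0 & forall theta M, 0 < theta < pi ->
    sigma <= sin theta -> M0 <= M -> theta / 2 - eps <= ideal_angle theta M M.
Proof.
move=> sg0 e0; exists (2 / (sigma * eps)); first by rewrite divr_gt0 ?mulr_gt0.
move=> theta M ht ss MM.
have M0 : 0 < M by apply: lt_le_trans MM; rewrite divr_gt0 ?mulr_gt0.
rewrite half_angleE// /ideal_angle.
have sM := sinh_gt0 M0; have cM := cosh_ge1 M.
have s0 : 0 < sin theta by lra.
have c1 := cos_geN1 theta; have c2 := cos_le1 theta.
set y := (1 + cos theta) / sin theta.
have -> : (cosh M + cosh M * cos theta) / (sinh M * sin theta) = cosh M / sinh M * y.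
  by rewrite /y; field; rewrite !gt_eqF.
have y0 : 0 <= y by rewrite divr_ge0; lra.
have coth1 : 1 <= cosh M / sinh M by rewrite ler_pdivlMr// mul1r ltW// cosh_gt_sinh.
(* coth M - 1 = 2 / (exp (2 M) - 1) *)
have cothM : (cosh M / sinh M - 1) * M <= 1.
  have -> : cosh M / sinh M - 1 = (cosh M - sinh M) / sinh M.
    by field; rewrite gt_eqF.
  rewrite mulrAC ler_pdivrMr// mul1r /cosh /sinh.
  have := expR_ge1Dx (M + M); have := expR_gt0 (- M).
  have : expR M = expR (M + M) * expR (- M) by rewrite -expRD addrK.
  by move=> -> ; set a := expR (- M); set b := expR (M + M); nra.
have yy : y <= cosh M / sinh M * y by rewrite ler_peMl.
have := ler_atanB yy.
suff : cosh M / sinh M * y - y <= eps by lra.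
have ys : y <= 2 / sigma.
  rewrite /y; apply: ler_pM; try lra.
    by rewrite invr_ge0 ltW.
  by rewrite lef_pV2.
move: MM; rewrite ler_pdivrMr ?mulr_gt0// => MM.
have ys' : y * sigma <= 2 by rewrite -ler_pdivlMr.
rewrite -[X in _ - X]mul1r -mulrBl.
set k := cosh M / sinh M - 1 in cothM *.
have k0 : 0 <= k by rewrite subr_ge0.
have h : k * y * (M * sigma) <= 2.
  have -> : k * y * (M * sigma) = (k * M) * (y * sigma) by ring.
  have -> : 2 = 1 * 2 :> R by ring.
  by apply: ler_pM => //; apply: mulr_ge0 => //; lra.
have Ms : 0 < M * sigma by rewrite mulr_gt0.
rewrite -(ler_pM2r Ms); apply: (le_trans h).
by rewrite (_ : eps * (M * sigma) = M * (sigma * eps))//; ring.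
Qed.

Lemma ideal_angle_bound theta p q : 0 <= ideal_angle theta p q <= pi.
Proof.
rewrite /ideal_angle; set z := (X in atan X).
by have := atan_gtNpi2 z; have := atan_ltpi2 z; lra.
Qed.

Lemma le_ideal_angle theta p q q' : 0 < p -> 0 < sin theta -> 0 <= q -> q <= q' ->
  ideal_angle theta p q' <= ideal_angle theta p q.
Proof.
move=> p0 s0 q0 qq; rewrite /ideal_angle lerD2l lerN2; apply: le_atan.
have s0' := mulr_gt0 (sinh_gt0 p0) s0.
by rewrite ler_pM2r ?invr_gt0// lerD2r ler_cosh.
Qed.

End AngleBarriers.

(** * Real functions on the half-line *)

Section RealVariable.
Context {R : realType}.
Implicit Types (f g df dg : R -> R) (t v A T : R).

(** The form in which limits are taken below: it gives the limit together with the
    rate of convergence. *)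
Lemma nested_intervals (I : Type) (i0 : I) (a b : I -> R) :
  (forall i j, a i <= b j) -> exists l, forall i, a i <= l <= b i.
Proof.
move=> ab; exists (sup (range a)) => i; apply/andP; split.
  apply: sup_upper_bound; last by exists i.
  by split; [exists (a i0), i0 | exists (b i0) => _ [j _ <-]].
apply: ge_sup; first by exists (a i0), i0.
by move=> _ [j _ <-].
Qed.

Lemma continuous_antiderivative g : continuous g ->
  exists F : R -> R, forall t, 0 <= t -> is_derive t 1 F (g t).
Proof.
move=> cg.
(* starting at -1 makes the derivative at 0 two-sided *)
exists (fun t => \int[lebesgue_measure]_(s in [set` `[-1, t]]) (g s))%R => t t0.
have h : t < t + 1 by lra.
have ig : (@lebesgue_measure R).-integrable `[-1, t + 1] (EFin \o g).
  apply: continuous_compact_integrable; first exact: segment_compact.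
  exact: continuous_subspaceT.
have t1 : -1 < t by lra.
have [d e] := continuous_FTC1_closed h ig t1 (cg t).
by apply: DeriveDef; [exact: d | rewrite -derive1E e].
Qed.

Lemma le_of_derive f g df dg T : 0 <= T ->
  (forall t, 0 <= t <= T -> is_derive t 1 f (df t)) ->
  (forall t, 0 <= t <= T -> is_derive t 1 g (dg t)) ->
  (forall t, 0 <= t <= T -> df t <= dg t) ->
  f 0 <= g 0 -> f T <= g T.
Proof.
move=> T0 hf hg hd h0.
have dh t : 0 <= t <= T -> is_derive t 1 (g - f) (dg t - df t).
  by move=> tT; have := hf _ tT; have := hg _ tT => ? ?; exact: is_deriveB.
have [||c ch] := @MVT_segment _ (g - f) (fun t => dg t - df t) 0 T T0.
- by move=> t; rewrite in_itv/= => ht; apply: dh; lra.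
- by apply: derivable_within_continuous => t; rewrite in_itv/= => ht; have [] := dh _ ht.
rewrite in_itv/= in ch; rewrite !fctE subr0.
have := mulr_ge0 (_ : 0 <= dg c - df c) T0; rewrite subr_ge0 hd// => /(_ isT).
lra.
Qed.

(** Multiplication by [exp (A t)] turns the hypothesis into a comparison of
    derivatives. *)
Lemma le_of_linear_derive A f g df dg T : 0 <= T ->
  (forall t, 0 <= t <= T -> is_derive t 1 f (df t)) ->
  (forall t, 0 <= t <= T -> is_derive t 1 g (dg t)) ->
  (forall t, 0 <= t <= T -> df t + A * f t <= dg t + A * g t) ->
  f 0 <= g 0 -> f T <= g T.
Proof.
move=> T0 hf hg hd h0.
pose E t := expR (A * t).
have dE t : is_derive t 1 E (A * E t).
  have hl : is_derive t 1 ( *%R A) A.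
    have -> : ( *%R A) = A *: id by [].
    by apply: is_derive_eq; rewrite /GRing.scale/= mulr1.
  have := @is_derive1_comp _ (@expR R) ( *%R A) t _ _ (is_derive_expR _) hl.
  by move=> h; apply: (@is_derive_eq _ _ _ _ _ _ _ _ h); rewrite mulrC.
have dEf (h : R -> R) dh t : is_derive t 1 h dh ->
    is_derive t 1 (E * h) (E t * (dh + A * h t)).
  move=> hh; have := is_deriveM (dE t) hh.
  move=> k; apply: (@is_derive_eq _ _ _ _ _ _ _ _ k).
  by rewrite /GRing.scale/=; ring.
have := @le_of_derive (E * f) (E * g) (fun t => E t * (df t + A * f t))
  (fun t => E t * (dg t + A * g t)) T T0.
have E0 t : 0 < E t by exact: expR_gt0.
rewrite !fctE !ler_pM2l//; apply => //.
- by move=> t ht; apply: dEf; exact: hf.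
- by move=> t ht; apply: dEf; exact: hg.
- by move=> t ht; rewrite ler_pM2l//; exact: hd.
Qed.

(** After the last time [s <= T] with [m <= f s], [f] would be below [m], hence
    nondecreasing, so it could not become less than [m]. *)
Lemma barrier_below f df m T : 0 <= T ->
  (forall t, 0 <= t <= T -> is_derive t 1 f (df t)) ->
  (forall t, 0 <= t <= T -> f t <= m -> 0 <= df t) ->
  m <= f 0 -> m <= f T.
Proof.
move=> T0 hf hd h0; rewrite leNgt; apply/negP => fT.
pose S := [set t | 0 <= t <= T /\ m <= f t].
have S0 : S 0 by split => //; rewrite lexx.
have hS : has_sup S by split; [exists 0 | exists T => t [/andP[]]].
have ubS t : S t -> t <= sup S by move=> St; exact: (sup_upper_bound hS).
have s0 : 0 <= sup S by exact: ubS.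
have sT : sup S <= T by apply: ge_sup; [exists 0 | move=> t [/andP[]]].
set s := sup S in s0 sT.
have cf t : 0 <= t <= T -> {for t, continuous f}.
  move=> /hf[df' _]; apply/differentiable_continuous.
  by rewrite -derivable1_diffP.
have fs : m <= f s.
  rewrite leNgt; apply/negP => fsm.
  have st : 0 <= s <= T by rewrite s0.
  have : \forall x \near s, f x < m.
    by have := cf _ st; move=> /(_ [set y | y < m]); apply; exact: lt_nbhsl.
  move=> /nbhs_ballP[e /= e0 he].
  have [x [/andP[x0 xT] mx] ex] := sup_adherent e0 hS.
  have xs : x <= s by apply: ubS; split => //; rewrite x0.
  have := he x; rewrite /ball/= ger0_norm; last by lra.
  have -> : s - x < e by rewrite /s in ex *; lra.
  by move=> /(_ isT); lra.
have sT' : s < T.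
  by rewrite lt_neqAle sT andbT; apply/negP => /eqP e; rewrite e in fs; lra.
have [||c ch e] := @MVT _ f df s T sT'.
- by move=> t; rewrite in_itv/= => ht; apply: hf; lra.
- apply: derivable_within_continuous => t; rewrite in_itv/= => ht.
  have tT : 0 <= t <= T by lra.
  by have [] := hf _ tT.
rewrite in_itv/= in ch.
have c0T : 0 <= c <= T by lra.
have fc : f c < m.
  rewrite ltNge; apply/negP => mc.
  have : c <= s by apply: ubS.
  lra.
have := hd _ c0T (ltW fc) => dc.
have : 0 <= df c * (T - s) by apply: mulr_ge0; lra.
lra.
Qed.

Lemma barrier_above f df m T : 0 <= T ->
  (forall t, 0 <= t <= T -> is_derive t 1 f (df t)) ->
  (forall t, 0 <= t <= T -> m <= f t -> df t <= 0) ->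
  f 0 <= m -> f T <= m.
Proof.
move=> T0 hf hd h0.
rewrite -lerN2; apply: (@barrier_below (- f) (- df) (- m)) => //.
- by move=> t /hf h; exact: is_deriveN.
- by move=> t ht; rewrite !fctE lerN2 oppr_ge0; exact: hd.
- by rewrite fctE lerN2.
Qed.

Lemma is_derive_half_line f t v : is_derive t 1 f v -> half_line_derive f t v.
Proof.
move=> h; split => // t0; subst t; case: h => d e.
have H : h^-1 *: (f (h *: 1 + 0) - f 0) @[h --> 0^'] --> v by rewrite -e.
apply: cvg_trans (cvg_dnbhs_at_right H).
apply: near_eq_cvg; near=> h.
by rewrite /GRing.scale/= mulr1 addr0.
Unshelve. all: by end_near. Qed.

(** Continuing a function affinely to negative times turns the one-sided derivative
    at [0] into a derivative, so that below all times [t >= 0] are treated alike. *)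
Lemma half_line_extension f df :
  (forall t, 0 <= t -> half_line_derive f t (df t)) ->
  exists2 g, (forall t, 0 <= t -> g t = f t) &
    forall t, 0 <= t -> is_derive t 1 g (df t).
Proof.
move=> hf; pose g t := if 0 <= t then f t else f 0 + t * df 0.
have gE t : 0 <= t -> g t = f t by rewrite /g => ->.
exists g => // t; rewrite le_eqVlt => /predU1P[<-|t0]; last first.
  have [h _] := hf _ (ltW t0).
  apply: near_eq_is_derive (h t0).
  near=> z; rewrite gE//; apply: ltW; near: z; exact: lt_nbhsr.
have [_ /(_ erefl) h] := hf 0 (lexx 0).
have H : h^-1 *: ((g \o shift 0) (h *: 1) - g 0) @[h --> 0^'] --> df 0.
  apply: (@cvg_at_right_left_dnbhs R R^o (fun h : R => h^-1 *: ((g \o shift 0) (h *: 1) - g 0)) 0 (df 0)).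
    apply: cvg_trans h; apply: near_eq_cvg; near=> z.
    have z0 : 0 < z by near: z; exact: nbhs_right_gt.
    by rewrite /GRing.scale/= mulr1 addr0 !gE// ltW.
  apply: (@cvg_trans _ (cst (df 0) @ 0^'-)); last exact: cvg_cst.
  apply: near_eq_cvg; near=> z.
  have z0 : z < 0 by near: z; exact: nbhs_left_lt.
  rewrite /GRing.scale/= mulr1 addr0 (gE 0)// /g leNgt z0/=.
  by rewrite addrAC subrr add0r mulKf// lt_eqF.
split; first by apply/cvg_ex; exists (df 0).
exact: (cvg_lim (@norm_hausdorff _ _) H).
Unshelve. all: by end_near. Qed.

End RealVariable.

(** * Picard iteration in the sup norm *)

Section Picard.
Context {R : realType}.

Lemma norm_le_of_derive (f g df dg : R -> R) (T : R) : 0 <= T ->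
  (forall t, 0 <= t <= T -> is_derive t 1 f (df t)) ->
  (forall t, 0 <= t <= T -> is_derive t 1 g (dg t)) ->
  (forall t, 0 <= t <= T -> `|df t| <= dg t) ->
  `|f 0| <= g 0 -> `|f T| <= g T.
Proof.
move=> T0 hf hg hd h0.
have h t (tT : 0 <= t <= T) : - dg t <= df t <= dg t by rewrite -ler_norml hd.
move: h0; rewrite !ler_norml => /andP[h01 h02]; apply/andP; split.
- rewrite lerNl; apply: (@le_of_derive _ (- f) g (- df) dg) => //.
  + by move=> t /hf k; exact: is_deriveN.
  + by move=> t tT; have := h t tT; rewrite fctE; lra.
  + by rewrite fctE lerNl.
- by apply: (@le_of_derive _ f g df dg) => // t tT; have := h t tT; lra.
Qed.

Lemma is_derive_scaled_exp (c mu t : R) :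
  is_derive t 1 (fun s => c * expR (mu * s)) (mu * (c * expR (mu * t))).
Proof.
have hl : is_derive t 1 ( *%R mu) mu.
  have -> : ( *%R mu) = mu *: id by [].
  by apply: is_derive_eq; rewrite /GRing.scale/= mulr1.
have h := @is_derive1_comp _ (@expR R) ( *%R mu) t _ _ (is_derive_expR _) hl.
have -> : (fun s => c * expR (mu * s)) = c *: (@expR R \o *%R mu) by [].
by apply: is_derive_eq; rewrite /GRing.scale/=; ring.
Qed.

Lemma le_geometric (x y c : R) : (forall n, x <= y + c * 2^-1 ^+ n) -> x <= y.
Proof.
move=> h; rewrite leNgt; apply/negP => yx.
have d0 : 0 < x - y by lra.
have := archi_boundP (divr_ge0 (normr_ge0 c) (ltW d0)).
set n := Num.bound _ => hn.
have h2 : (n%:R : R) <= 2 ^+ n by rewrite -natrX ler_nat ltnW// ltn_expl.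
have P0 : 0 < (2 : R) ^+ n by rewrite exprn_gt0.
have cn : `|c| < 2 ^+ n * (x - y).
  by rewrite -ltr_pdivrMr//; lra.
have := h n; rewrite exprVn.
have : c / 2 ^+ n < x - y by rewrite ltr_pdivrMr// mulrC (le_lt_trans (ler_norm c)).
lra.
Qed.

Variables (V : Type) (G : (V -> R) -> V -> R) (L B : R) (p0 : V -> R).
Hypotheses (L0 : 0 <= L) (B0 : 0 <= B).
Hypothesis G_lipschitz : forall p q (e : R) i, (forall j, `|p j - q j| <= e) ->
  `|G p i - G q i| <= L * e.
Hypothesis G_bounded : forall p i, `|G p i| <= B.

(** Equicontinuity over the possibly infinite index set [V]: it makes
    [s |-> G (U s) i] continuous. *)
Let speed_le_B (U : R -> V -> R) := forall (s t : R) i, 0 <= s -> 0 <= t ->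
  `|U s i - U t i| <= B * `|s - t|.

Let picard_step U : speed_le_B U -> exists W, speed_le_B W /\
  (forall i, W 0 i = p0 i) /\
  forall (t : R) i, 0 <= t -> is_derive t 1 (W ^~ i) (G (U t) i).
Proof.
move=> hU.
(* the iterates are controlled for t >= 0 only, whence the maximum *)
have cg i : continuous (fun s : R => G (U (Num.max 0 s)) i : R).
  move=> s; apply/cvgrPdist_le => e e0.
  have LB : 0 < L * B + 1 by have := mulr_ge0 L0 B0; lra.
  have d0 : 0 < e / (L * B + 1) by rewrite divr_gt0.
  near=> z.
  have sz : `|s - z| <= e / (L * B + 1).
    by near: z; exact: cvgr_dist_le.
  apply: (@le_trans _ _ (L * (B * `|s - z|))).
    apply: G_lipschitz => j; apply: (le_trans (hU _ _ _ _ _)).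
    - by rewrite le_max lexx.
    - by rewrite le_max lexx.
    - rewrite ler_wpM2l//.
      have := lexx `|s - z|.
      rewrite /Num.max; case: ltP => s1; case: ltP => z1 //; rewrite ?subrr ?normr0//.
      + by rewrite subr0 !ger0_norm; lra.
      + by rewrite sub0r normrN ler0_norm ?ger0_norm; lra.
  move: sz; rewrite ler_pdivlMr// => sz.
  by have := normr_ge0 (s - z); nra.
have /choice[F hF] : forall i, exists F : R -> R, forall t : R, 0 <= t ->
    is_derive t 1 F (G (U t) i).
  move=> i; have [F hF] := continuous_antiderivative (cg i).
  by exists F => t t0; have := hF t t0; rewrite max_r.
pose W t i := p0 i + (F i t - F i 0).
have dW (t : R) i : 0 <= t -> is_derive t 1 (W ^~ i) (G (U t) i).
  move=> t0; have h := hF i t t0.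
  have -> : W ^~ i = cst (p0 i - F i 0) + F i.
    by apply/funext => s; rewrite /W/= fctE/=; ring.
  by apply: is_derive_eq; rewrite add0r.
exists W; split; last by split=> // i; rewrite /W subrr addr0.
suff h (s t : R) i : 0 <= s -> s <= t -> `|W t i - W s i| <= B * (t - s).
  move=> s t i s0 t0; case: (leP s t) => st.
    by rewrite distrC (distrC s) (ger0_norm (x := t - s)) ?subr_ge0//; exact: h.
  by rewrite (ger0_norm (x := s - t)) ?subr_ge0 ?(ltW st)//; apply: h => //; exact: ltW.
move=> s0; rewrite le_eqVlt => /predU1P[->|st]; first by rewrite !subrr normr0 mulr0.
have [||c ch ->] := @MVT _ (W ^~ i) (fun t => G (U t) i) s t st.
- by move=> z; rewrite in_itv/= => hz; apply: dW; lra.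
- apply: derivable_within_continuous => z; rewrite in_itv/= => hz.
  have z0 : 0 <= z by lra.
  by have [] := dW z i z0.
rewrite normrM (ger0_norm (x := t - s)) ?subr_ge0 ?(ltW st)//.
by rewrite ler_wpM2r ?G_bounded// subr_ge0 (ltW st).
Unshelve. all: by end_near. Qed.

(** In the norm [sup |p t i| exp (- mu t)] over all [t >= 0] and [i] with
    [mu >= 2 L], an integration step is a contraction with ratio [1 / 2], so the
    iterates converge on the whole half-line at once. *)
Lemma picard : exists p : R -> V -> R, (forall i, p 0 i = p0 i) /\
  forall (t : R) i, 0 <= t -> is_derive t 1 (p ^~ i) (G (p t) i).
Proof.
have /choice[T hT] : forall U : {U | speed_le_B U}, exists W : {W | speed_le_B W},
    (forall i, sval W 0 i = p0 i) /\
    forall (t : R) i, 0 <= t -> is_derive t 1 (sval W ^~ i) (G (sval U t) i).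
  by move=> [U hU]; have [W [h1 h2]] := picard_step hU; exists (exist _ W h1).
have h0 : speed_le_B (fun _ => p0).
  by move=> s t i _ _; rewrite subrr normr0 mulr_ge0.
pose u n := iter n T (exist _ _ h0).
have uS n : speed_le_B (sval (u n)) by exact: svalP.
have u00 n i : sval (u n) 0 i = p0 i by case: n => //= n; have [] := hT (u n).
have uD n (t : R) i : 0 <= t -> is_derive t 1 (sval (u n.+1) ^~ i) (G (sval (u n) t) i).
  by move=> t0; have [_] := hT (u n); apply.
pose mu := 2 * L + 1.
have mu1 : 1 <= mu by rewrite /mu lerDr mulr_ge0.
(* each integration halves the weighted distance, because L <= mu / 2 *)
have contr (X Y X' Y' : R -> V -> R) (C : R) : 0 <= C ->
    (forall i, X' 0 i = p0 i) -> (forall i, Y' 0 i = p0 i) ->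
    (forall (t : R) i, 0 <= t -> is_derive t 1 (X' ^~ i) (G (X t) i)) ->
    (forall (t : R) i, 0 <= t -> is_derive t 1 (Y' ^~ i) (G (Y t) i)) ->
    (forall (t : R) i, 0 <= t -> `|X t i - Y t i| <= C * expR (mu * t)) ->
    forall (t : R) i, 0 <= t -> `|X' t i - Y' t i| <= C / 2 * expR (mu * t).
  move=> C0 X0 Y0 dX dY XY t i t0.
  have e0 s : 0 <= C * expR (mu * s) by rewrite mulr_ge0 ?expR_ge0.
  apply: (@norm_le_of_derive (fun s => X' s i - Y' s i)
    (fun s => C / 2 * expR (mu * s)) (fun s => G (X s) i - G (Y s) i)
    (fun s => mu * (C / 2 * expR (mu * s))) t t0).
  - move=> s /andP[s0 _]; have := dX s i s0; have := dY s i s0 => ? ?.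
    exact: is_deriveB.
  - by move=> s _; exact: is_derive_scaled_exp.
  - move=> s /andP[s0 _].
    apply: le_trans (G_lipschitz i (fun j => XY s j s0)) _.
    have -> : mu * (C / 2 * expR (mu * s)) = (L + 2^-1) * (C * expR (mu * s)).
      by rewrite {1}/mu; field.
    by rewrite ler_wpM2r//; lra.
  - by rewrite X0 Y0 subrr normr0 mulr_ge0 ?expR_ge0//; lra.
have hu n (t : R) i : 0 <= t ->
    `|sval (u n.+1) t i - sval (u n) t i| <= B * 2^-1 ^+ n * expR (mu * t).
  elim: n t i => [|n IH] t i t0.
    rewrite expr0 mulr1; have := uS 1%N t 0 i t0 (lexx 0).
    rewrite u00 subr0 (ger0_norm t0) => /le_trans; apply; apply: ler_wpM2l => //.
    by have := expR_ge1Dx (mu * t); nra.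
  rewrite exprSr mulrA.
  have C0 : 0 <= B * 2^-1 ^+ n by rewrite mulr_ge0// exprn_ge0.
  exact: (contr _ _ _ _ _ C0 (u00 n.+2) (u00 n.+1) (uD n.+1) (uD n) IH).
(* subtracting the tail of the geometric series makes the induction on k go
   through *)
have tel n k (t : R) i : 0 <= t -> `|sval (u (n + k)%N) t i - sval (u n) t i| <=
    2 * B * 2^-1 ^+ n * expR (mu * t) - 2 * B * 2^-1 ^+ (n + k) * expR (mu * t).
  move=> t0; elim: k => [|k IH]; first by rewrite addn0 !subrr normr0.
  rewrite addnS; have := hu (n + k)%N t i t0.
  have := ler_normD (sval (u (n + k).+1) t i - sval (u (n + k)%N) t i)
    (sval (u (n + k)%N) t i - sval (u n) t i).
  rewrite addrA subrK exprSr; lra.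
have near_u n k (t : R) i : 0 <= t -> `|sval (u (n + k)%N) t i - sval (u n) t i| <=
    2 * B * 2^-1 ^+ n * expR (mu * t).
  move=> t0; apply: (le_trans (tel n k t i t0)); rewrite gerBl.
  by rewrite !mulr_ge0 ?exprn_ge0 ?expR_ge0.
have /choice[P hP] : forall ti : R * V, exists l : R, 0 <= ti.1 -> forall n,
    `|sval (u n) ti.1 ti.2 - l| <= 2 * B * 2^-1 ^+ n * expR (mu * ti.1).
  move=> [t i] /=; case: (leP 0 t) => [t0|_]; last by exists 0.
  have [|l hl] := @nested_intervals _ _ 0%N
    (fun n => sval (u n) t i - 2 * B * 2^-1 ^+ n * expR (mu * t))
    (fun n => sval (u n) t i + 2 * B * 2^-1 ^+ n * expR (mu * t)).
    move=> m n.
    have pos k : 0 <= 2 * B * 2^-1 ^+ k * expR (mu * t).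
      by rewrite !mulr_ge0 ?exprn_ge0 ?expR_ge0.
    have := pos m; have := pos n.
    case: (leqP m n) => [/subnKC <-|/ltnW /subnKC <-].
      by have := near_u m (n - m)%N t i t0; rewrite ler_norml; lra.
    by have := near_u n (m - n)%N t i t0; rewrite ler_norml; lra.
  by exists l => _ n; have := hl n; rewrite ler_norml; lra.
pose p t i := P (t, i).
have up n (t : R) i : 0 <= t ->
    `|sval (u n) t i - p t i| <= 2 * B * 2^-1 ^+ n * expR (mu * t).
  by move=> t0; exact: (hP (t, i) t0).
have pS : speed_le_B p.
  move=> s t i s0 t0.
  apply: (@le_geometric _ _ (2 * B * expR (mu * s) + 2 * B * expR (mu * t))) => n.
  have := up n s i s0; have := up n t i t0; have := uS n s t i s0 t0.
  set b := B * `|s - t|; rewrite !ler_norml; lra.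
have [W [_ [W0 dW]]] := picard_step pS.
have Wp (t : R) i : 0 <= t -> W t i = p t i.
  move=> t0; apply/eqP; rewrite -subr_eq0 -normr_le0.
  apply: (@le_geometric _ _ (4 * B * expR (mu * t))) => n; rewrite add0r.
  have h1 := up n.+1 t i t0.
  have h2 : `|sval (u n.+1) t i - W t i| <= 2 * B * 2^-1 ^+ n / 2 * expR (mu * t).
    have C0 : 0 <= 2 * B * 2^-1 ^+ n by rewrite !mulr_ge0 ?exprn_ge0.
    exact: (contr _ _ _ _ _ C0 (u00 n.+1) W0 (uD n) dW (up n)).
  move: h1 h2; rewrite exprSr.
  have : 0 <= B * 2^-1 ^+ n * expR (mu * t) by rewrite !mulr_ge0 ?exprn_ge0 ?expR_ge0.
  rewrite !ler_norml; lra.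
exists W; split=> // t i t0.
have h := dW t i t0; apply: is_derive_eq.
apply/eqP; rewrite -subr_eq0 -normr_le0 -(mulr0 L).
by apply: G_lipschitz => j; rewrite Wp// subrr normr0.
Qed.

End Picard.

(** * The flow in the dual radii *)

Section DualFlow.
Context {R : realType} {V H : Type}.
Variables (star : V -> seq H) (tgt : H -> V) (Th : H -> R).
Implicit Types (p q : V -> R) (i : V) (m M e t : R).

(** The graph enters only through the list of half-edges at each vertex and their
    targets. *)
Definition dual_curvature p i : R :=
  2 * pi - 2 * \sum_(h <- star i) ideal_angle (Th h) (p i) (p (tgt h)).

Definition in_box m M p := forall i, m <= p i <= M.

Lemma sum_const_seq (s : seq H) (c : R) : \sum_(h <- s) c = (size s)%:R * c.
Proof. by rewrite big_const_seq count_predT iter_addr_0 mulr_natl. Qed.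

Variables (sigma kappa dhat : R).
Hypotheses (sigma_gt0 : 0 < sigma) (kappa_gt0 : 0 < kappa).
Hypothesis Th_itv : forall h, 0 < Th h < pi.
Hypothesis sigma_le : forall h, sigma <= sin (Th h).
Hypothesis kappa_le : forall h, kappa <= 1 + cos (Th h).
Hypothesis star_neq0 : forall i, (0 < size (star i))%N.
Hypothesis star_le : forall i, (size (star i))%:R <= dhat.

Let size_ge1 i : 1 <= (size (star i))%:R :> R.
Proof. by rewrite ler1n. Qed.

(** All angles lie in [[0, pi]], so the curvature is bounded independently of the
    metric. *)
Definition speed_bound : R := 2 * pi + 2 * pi * dhat.

Lemma dual_curvature_bounded p i : `|dual_curvature p i| <= speed_bound.
Proof.
rewrite /dual_curvature /speed_bound.
have pi0 := pi_gt0 R.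
have s0 : 0 <= \sum_(h <- star i) ideal_angle (Th h) (p i) (p (tgt h)).
  by apply: sumr_ge0 => h _; have /andP[] := ideal_angle_bound (Th h) (p i) (p (tgt h)).
have s1 : \sum_(h <- star i) ideal_angle (Th h) (p i) (p (tgt h)) <= dhat * pi.
  apply: (@le_trans _ _ (\sum_(h <- star i) pi)).
    by apply: ler_sum => h _; have /andP[] := ideal_angle_bound (Th h) (p i) (p (tgt h)).
  by rewrite sum_const_seq ler_wpM2r// ltW.
by rewrite ler_norml; nra.
Qed.

Section Box.
Variables (m M : R).
Hypotheses (m_gt0 : 0 < m) (mM : m <= M).

Let Lp := angle_lipschitz sigma m M.
Let lam := angle_contraction sigma kappa M.

(** [damping] is such that [K_i + damping * p_i] is nondecreasing in every
    coordinate on the box.  [decay_rate] bounds from below the speed at which [K_i]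
    decreases when all coordinates grow at unit speed; this uses that degrees are
    at least [1]. *)
Definition decay_rate : R := 2 * lam.
Definition damping : R := 2 * dhat * Lp.

Let lam_gt0 : 0 < lam.
Proof.
have c0 : 0 < cosh M by have := cosh_ge1 M; lra.
by apply: divr_gt0; apply: mulr_gt0 => //; exact: exprn_gt0.
Qed.

Let Lp_ge0 : 0 <= Lp.
Proof. by apply: divr_ge0; [apply: mulr_ge0 => // | ]; exact: sqr_ge0. Qed.

Lemma decay_rate_gt0 : 0 < decay_rate.
Proof. by rewrite /decay_rate mulr_gt0. Qed.

Let dhat_ge1 i : 1 <= dhat.
Proof. exact: le_trans (size_ge1 i) (star_le i). Qed.

(** The contribution of one half-edge; summing over the star gives the next two
    lemmas. *)
Let angle_step p q e i h : in_box m M p -> in_box m M q ->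
  (forall j, `|p j - q j| <= e) ->
  let D := ideal_angle (Th h) (p i) (p (tgt h)) -
           ideal_angle (Th h) (q i) (q (tgt h)) in
  `|D| <= 2 * Lp * e /\ Lp * (p i - q i) - D <= (Lp - lam) * e.
Proof.
move=> hp hq he /=.
have hs : 0 < sigma <= sin (Th h) by rewrite sigma_gt0 sigma_le.
have hk : 0 < kappa <= 1 + cos (Th h) by rewrite kappa_gt0 kappa_le.
have [P [Q [-> Q0 PQ PL]]] :=
  ideal_angle_increment hs hk m_gt0 (hp i) (hp (tgt h)) (hq i) (hq (tgt h)).
rewrite -/lam in PQ; rewrite -/Lp in PL.
have := he i; have := he (tgt h).
set a := p i - q i; set b := p (tgt h) - q (tgt h).
rewrite !ler_norml => /andP[b1 b2] /andP[a1 a2].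
have l0 := lam_gt0.
have e0 : 0 <= e by lra.
have P0 : 0 <= P by lra.
have Pa1 : P * a <= P * e by rewrite ler_wpM2l.
have Pa2 : - (P * e) <= P * a by rewrite -mulrN ler_wpM2l.
have Qb1 : Q * b <= - Q * e by rewrite mulNr -mulrN ler_wnM2l.
have Qb2 : Q * e <= Q * b by rewrite ler_wnM2l.
have LPa : (Lp - P) * a <= (Lp - P) * e by rewrite ler_wpM2l// subr_ge0.
have PQe : lam * e <= (P + Q) * e by rewrite ler_wpM2r.
have PLe : P * e <= Lp * e by rewrite ler_wpM2r.
have le0 : 0 <= lam * e by rewrite mulr_ge0// ltW.
split; last by lra.
by apply/andP; split; lra.
Qed.

Lemma dual_curvature_lipschitz p q e i : in_box m M p -> in_box m M q ->
  (forall j, `|p j - q j| <= e) ->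
  `|dual_curvature p i - dual_curvature q i| <= 2 * damping * e.
Proof.
move=> hp hq he.
have e0 : 0 <= e by exact: le_trans (normr_ge0 _) (he i).
have -> : dual_curvature p i - dual_curvature q i = - 2 * \sum_(h <- star i)
    (ideal_angle (Th h) (p i) (p (tgt h)) - ideal_angle (Th h) (q i) (q (tgt h))).
  by rewrite sumrB /dual_curvature; ring.
rewrite normrM normrN (ger0_norm (x := 2))// /damping.
have -> : 2 * (2 * dhat * Lp) * e = 2 * (dhat * (2 * Lp * e)) by ring.
rewrite ler_pM2l//; apply: (le_trans (ler_norm_sum _ _ _)).
apply: (@le_trans _ _ (\sum_(h <- star i) (2 * Lp * e))).
  by apply: ler_sum => h _; have [] := angle_step i h hp hq he.
rewrite sum_const_seq; apply: ler_wpM2r; last exact: star_le.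
by apply: mulr_ge0 => //; exact: mulr_ge0.
Qed.

(** Diagonal dominance in integrated form.  By the choice of [damping] the
    left-hand side is nondecreasing in all differences [p j - q j], hence largest
    when they all equal [e]; then the curvatures differ by at most
    [- decay_rate * e]. *)
Lemma dual_curvature_dissipative p q e i : in_box m M p -> in_box m M q ->
  (forall j, `|p j - q j| <= e) ->
  dual_curvature p i - dual_curvature q i + damping * (p i - q i) <=
    (damping - decay_rate) * e.
Proof.
move=> hp hq he.
have e0 : 0 <= e by exact: le_trans (normr_ge0 _) (he i).
have -> : dual_curvature p i - dual_curvature q i = - 2 * \sum_(h <- star i)
    (ideal_angle (Th h) (p i) (p (tgt h)) - ideal_angle (Th h) (q i) (q (tgt h))).
  by rewrite sumrB /dual_curvature; ring.
have : \sum_(h <- star i) (Lp * (p i - q i) -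
    (ideal_angle (Th h) (p i) (p (tgt h)) - ideal_angle (Th h) (q i) (q (tgt h)))) <=
    \sum_(h <- star i) ((Lp - lam) * e).
  by apply: ler_sum => h _; have [] := angle_step i h hp hq he.
rewrite sumrB !sum_const_seq; set S := \sum_(h <- star i) _; set d := _%:R.
have d1 : 1 <= d by exact: size_ge1.
have dd : d <= dhat by exact: star_le.
have a1 : p i - q i <= e by exact: le_trans (ler_norm _) (he i).
have k1 : (dhat - d) * Lp * (p i - q i) <= (dhat - d) * Lp * e.
  by rewrite ler_wpM2l// mulr_ge0// subr_ge0.
have k2 : 1 * (lam * e) <= d * (lam * e).
  by rewrite ler_wpM2r// mulr_ge0// ltW.
rewrite /damping /decay_rate; lra.
Qed.

Definition flows_on T (p : R -> V -> R) := forall t i, 0 <= t <= T ->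
  in_box m M (p t) /\ is_derive t 1 (p ^~ i) (dual_curvature (p t) i).

(** A bound [N exp (- decay_rate t) + b exp (damping t)] on all coordinates improves
    to the same bound with [b / 2] by a linear comparison in each coordinate
    separately ([half]).  Starting from [b = M - m], iteration leaves the first
    term only. *)
Lemma flow_contraction (T N : R) (p q : R -> V -> R) : flows_on T p -> flows_on T q ->
  (forall i, `|p 0 i - q 0 i| <= N) ->
  forall t i, 0 <= t <= T -> `|p t i - q t i| <= N * expR (- decay_rate * t).
Proof.
have half n (x y : R -> V -> R) : flows_on T x -> flows_on T y ->
    (forall i, `|x 0 i - y 0 i| <= N) ->
    (forall t i, 0 <= t <= T -> `|x t i - y t i| <=
      N * expR (- decay_rate * t) + (M - m) * 2^-1 ^+ n * expR (damping * t)) ->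
    forall t i, 0 <= t <= T -> x t i - y t i <=
      N * expR (- decay_rate * t) + (M - m) * 2^-1 ^+ n.+1 * expR (damping * t).
  move=> hx hy h0 IH t i /andP[t0 tT].
  pose c := (M - m) * 2^-1 ^+ n.+1.
  have c0 : 0 <= c by rewrite mulr_ge0 ?exprn_ge0// subr_ge0.
  apply: (@le_of_linear_derive _ damping (fun s => x s i - y s i)
    (fun s => N * expR (- decay_rate * s) + c * expR (damping * s))
    (fun s => dual_curvature (x s) i - dual_curvature (y s) i)
    (fun s => - decay_rate * (N * expR (- decay_rate * s)) +
              damping * (c * expR (damping * s))) t t0).
  - move=> s /andP[s0 st]; have sT : 0 <= s <= T by lra.
    have [_ dx] := hx s i sT; have [_ dy] := hy s i sT; exact: is_deriveB.
  - move=> s _.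
    have k1 := is_derive_scaled_exp N (- decay_rate) s.
    have k2 := is_derive_scaled_exp c damping s.
    exact: is_deriveD.
  - move=> s /andP[s0 st]; have sT : 0 <= s <= T by lra.
    have [bx _] := hx s i sT; have [by_ _] := hy s i sT.
    have := dual_curvature_dissipative i bx by_ (fun j => IH s j sT).
    have -> : (M - m) * 2^-1 ^+ n = 2 * c by rewrite /c exprS; field.
    have : 0 <= decay_rate * (c * expR (damping * s)).
      by apply: mulr_ge0; [exact: ltW decay_rate_gt0 | rewrite mulr_ge0 ?expR_ge0].
    set E1 := expR (- decay_rate * s); set E2 := expR (damping * s).
    lra.
  - rewrite !mulr0 expR0 !mulr1; have := h0 i; rewrite ler_norml; lra.
move=> hp hq h0 t i tT.
suff key n : forall t i, 0 <= t <= T -> `|p t i - q t i| <=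
    N * expR (- decay_rate * t) + (M - m) * 2^-1 ^+ n * expR (damping * t).
  apply: (@le_geometric _ _ _ ((M - m) * expR (damping * t))) => n.
  by rewrite mulrAC; exact: key.
elim: n => [|n IH] {tT}t {}i tT.
  have [bp _] := hp t i tT; have [bq _] := hq t i tT.
  have N0 : 0 <= N by exact: le_trans (normr_ge0 _) (h0 i).
  have : 0 <= N * expR (- decay_rate * t) by rewrite mulr_ge0 ?expR_ge0.
  have dl1 : 0 <= damping * t.
    rewrite mulr_ge0//; last by case/andP: tT.
    by apply: mulr_ge0 => //; have := dhat_ge1 i; lra.
  have E1 : 1 <= expR (damping * t) by have := expR_ge1Dx (damping * t); lra.
  have : (M - m) * 1 <= (M - m) * expR (damping * t) by rewrite ler_wpM2l// subr_ge0.
  have := bp i; have := bq i; rewrite expr0 mulr1 ler_norml; lra.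
rewrite ler_norml; apply/andP; split; last exact: (half n p q).
rewrite lerNl opprB; apply: (half n q p) => //.
  by move=> j; rewrite distrC.
by move=> s j sT; rewrite distrC; exact: IH.
Qed.


Definition clip (x : R) : R := Num.max m (Num.min M x).

Let clip_cases x : [\/ x <= m /\ clip x = m, m <= x <= M /\ clip x = x
  | M <= x /\ clip x = M].
Proof.
rewrite /clip; case: (leP M x) => h1.
  by constructor 3; split=> //; exact: max_r.
case: (leP m x) => h2; last by constructor 1; split=> //; exact: ltW.
by constructor 2; split=> //; exact: ltW.
Qed.

Let clip_itv x : m <= clip x <= M.
Proof. by have := mM; have := clip_cases x => -[] [h ->]; lra. Qed.

Let clip_dist x y : `|clip x - clip y| <= `|x - y|.
Proof.
have mM' := mM; have := ler_norm (x - y); have := ler_norm (y - x); rewrite (distrC y).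
move: (`|x - y|) => d h1 h2.
by rewrite ler_norml; have := clip_cases x => -[] [h ->];
  have := clip_cases y => -[] [h' ->]; lra.
Qed.

(** Picard iteration solves the flow of the clipped field.  Because only clipped
    values enter, the barriers concern one coordinate at a time: below [m] the
    coordinate does not decrease, above [M] it does not increase. *)
Lemma flow_exists p0 :
  (forall p i, 0 < p i <= m -> 0 <= dual_curvature p i) ->
  (forall p i, p i = M -> (forall j, 0 < p j <= M) -> dual_curvature p i <= 0) ->
  in_box m M p0 ->
  exists p : R -> V -> R, p 0 = p0 /\ forall T, flows_on T p.
Proof.
move=> lowK highK hp0; have m0 := m_gt0; have mM' := mM.
have [[i0]|V0] := pselect (inhabited V); last first.
  by exists (fun _ => p0); split=> // T t i; case: V0.
have d1 : 1 <= dhat by exact: dhat_ge1 i0.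
pose G (p : V -> R) := dual_curvature (clip \o p).
have cbox p : in_box m M (clip \o p) by move=> i; exact: clip_itv.
have [||p q e i he|p i|p [p00 dp]] := @picard R V G (2 * damping) speed_bound p0.
- by rewrite /damping; have := mulr_ge0 (_ : 0 <= dhat) Lp_ge0; lra.
- by rewrite /speed_bound; have := pi_gt0 R; nra.
- apply: dual_curvature_lipschitz => // j.
  by apply: le_trans (he j); exact: clip_dist.
- exact: dual_curvature_bounded.
have pbox t : 0 <= t -> in_box m M (p t).
  move=> t0 i; have /andP[h1 h2] := hp0 i; apply/andP; split.
  - apply: (@barrier_below _ (p ^~ i) (fun s => G (p s) i) m t t0) => //; last by rewrite p00.
      by move=> s /andP[s0 _]; exact: dp.
    move=> s _ pm; apply: lowK => /=.
    by have := clip_cases (p s i) => -[] [h ->]; lra.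
  - apply: (@barrier_above _ (p ^~ i) (fun s => G (p s) i) M t t0) => //; last by rewrite p00.
      by move=> s /andP[s0 _]; exact: dp.
    move=> s _ pm; apply: highK => [|j] /=.
      by have := clip_cases (p s i) => -[] [h ->]; lra.
    by have := clip_itv (p s j); lra.
exists p; split; first exact/funext.
move=> T t i /andP[t0 _]; split; first exact: pbox.
have := dp t i t0; rewrite /G; congr (is_derive _ _ _ (dual_curvature _ _)).
apply/funext => j /=.
by have := pbox t t0 j; have := clip_cases (p t j) => -[] [h ->]; lra.
Qed.

Let flow_derive (p : R -> V -> R) (s : R) j : (forall T, flows_on T p) -> 0 <= s ->
  is_derive s 1 (p ^~ j) (dual_curvature (p s) j).
Proof. by move=> hp s0; have [|_] := hp s s j; rewrite ?s0 ?lexx. Qed.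

Let flow_box (p : R -> V -> R) (s : R) j : (forall T, flows_on T p) -> 0 <= s ->
  m <= p s j <= M.
Proof. by move=> hp s0; have [|+ _] := hp s s j; rewrite ?s0 ?lexx// => /(_ j). Qed.

Lemma flow_shift (p : R -> V -> R) (u : R) : 0 <= u -> (forall T, flows_on T p) ->
  forall T, flows_on T (fun s => p (s + u)).
Proof.
move=> u0 hp T s j /andP[s0 _]; have su : 0 <= s + u by lra.
split; first by move=> k; exact: flow_box.
have h1 : is_derive s 1 (fun z : R => z + u) 1.
  have -> : (fun z : R => z + u) = id + cst u by [].
  by apply: is_derive_eq; rewrite addr0.
have := @is_derive1_comp _ (p ^~ j) (fun z => z + u) s _ _ (flow_derive j hp su) h1.
by rewrite mulr1.
Qed.

(** Contraction between the solution and its shift by a small time [u] bounds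
    [(p (t + u) - p t) / u] by [speed_bound exp (- decay_rate t)].  This quotient is
    a curvature at a time between [t] and [t + u], hence tends to the curvature at
    time [t]. *)
Lemma flow_curvature_decay (p : R -> V -> R) : (forall T, flows_on T p) ->
  forall t i, 0 <= t -> `|dual_curvature (p t) i| <= speed_bound * expR (- decay_rate * t).
Proof.
move=> hp t i t0.
have B0 : 0 <= speed_bound by exact: le_trans (normr_ge0 _) (dual_curvature_bounded (p 0) i).
have D0 : 0 <= damping by apply: mulr_ge0 => //; have := dhat_ge1 i; lra.
have dp (s : R) j : 0 <= s -> is_derive s 1 (p ^~ j) (dual_curvature (p s) j).
  exact: flow_derive.
have bp s : 0 <= s -> in_box m M (p s) by move=> s0 j; exact: flow_box.
have speed (s u : R) j : 0 <= s -> 0 <= u -> exists2 c, s <= c <= s + u &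
    p (s + u) j - p s j = dual_curvature (p c) j * u.
  move=> s0 u0.
  have [|||c ch e] := @MVT_segment _ (p ^~ j) (fun z => dual_curvature (p z) j) s (s + u).
  - lra.
  - by move=> z; rewrite in_itv/= => hz; apply: dp; lra.
  - apply: derivable_within_continuous => z; rewrite in_itv/= => hz.
    have z0 : 0 <= z by lra.
    by have [] := dp z j z0.
  by exists c => //; rewrite e; congr (_ * _); lra.
have lip (s u : R) j : 0 <= s -> 0 <= u -> `|p (s + u) j - p s j| <= speed_bound * u.
  move=> s0 u0; have [c _ ->] := speed s u j s0 u0.
  by rewrite normrM (ger0_norm u0) ler_wpM2r// dual_curvature_bounded.
apply: (@le_geometric _ _ _ (2 * damping * speed_bound)) => n.
set u := 2^-1 ^+ n.
have u0 : 0 < u by rewrite exprn_gt0.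
have shift : `|p (t + u) i - p t i| <= speed_bound * u * expR (- decay_rate * t).
  have tt : 0 <= t <= t by rewrite t0 lexx.
  have hq := flow_shift (ltW u0) hp (T := t).
  apply: (@flow_contraction t (speed_bound * u) (fun s => p (s + u)) p hq (hp t) _ t i tt).
  by move=> j; have := lip 0 u j (lexx 0) (ltW u0).
have [c hc e] := speed t u i t0 (ltW u0).
move: shift; rewrite e normrM (gtr0_norm u0) mulrAC ler_pM2r// => hcK.
have near_c : `|dual_curvature (p t) i - dual_curvature (p c) i| <=
    2 * damping * (speed_bound * u).
  apply: dual_curvature_lipschitz; [by apply: bp; lra|by apply: bp; lra|move=> j].
  have ct : 0 <= c - t by lra.
  have := lip t (c - t) j t0 ct; rewrite (addrC t) subrK distrC => /le_trans; apply.
  by rewrite ler_wpM2l//; lra.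
have := ler_normD (dual_curvature (p t) i - dual_curvature (p c) i) (dual_curvature (p c) i).
rewrite subrK; lra.
Qed.

Let le_of_decay x y c : 0 <= c ->
  (forall t, 0 <= t -> x <= y + c * expR (- decay_rate * t)) -> x <= y.
Proof.
move=> c0 h; have l0 := decay_rate_gt0.
apply: (@le_geometric _ _ _ c) => n.
(* at this time the exponential is exp (- n) <= 2 ^ (- n) *)
have t0 : 0 <= n%:R / decay_rate by rewrite divr_ge0// ltW.
apply: (le_trans (h _ t0)); rewrite lerD2l ler_wpM2l//.
have -> : - decay_rate * (n%:R / decay_rate) = n%:R * (- 1).
  by field; rewrite gt_eqF.
have e2 : expR (- 1) <= 2^-1 :> R.
  by rewrite expRN lef_pV2 ?posrE ?expR_gt0//; have := expR_ge1Dx (1 : R); lra.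
by rewrite expRM_natl lerXn2r ?nnegrE ?expR_ge0.
Qed.

(** Any two points of the box are at distance at most [M - m], so contraction
    between the solution and its shift by [t - s] gives
    [|p t i - p s i| <= (M - m) exp (- decay_rate s)] for [s <= t]. *)
Lemma flow_converges (p : R -> V -> R) : (forall T, flows_on T p) ->
  exists pinf, [/\ in_box m M pinf, forall i, dual_curvature pinf i = 0 &
    forall t i, 0 <= t -> `|p t i - pinf i| <= (M - m) * expR (- decay_rate * t)].
Proof.
move=> hp.
have bp s j : 0 <= s -> m <= p s j <= M by exact: flow_box.
pose W t := (M - m) * expR (- decay_rate * t).
have mM0 : 0 <= M - m by rewrite subr_ge0.
have W0 t : 0 <= W t by rewrite mulr_ge0 ?expR_ge0.
have cauchy s t i : 0 <= s -> s <= t -> `|p t i - p s i| <= W s.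
  move=> s0 st; pose u := t - s; have u0 : 0 <= u by rewrite subr_ge0.
  have hq := flow_shift u0 hp (T := s).
  have ss : 0 <= s <= s by rewrite s0 lexx.
  have -> : t = s + u by rewrite /u addrC subrK.
  apply: (@flow_contraction s (M - m) (fun z => p (z + u)) p hq (hp s) _ s i ss).
  move=> j; have := bp (0 + u) j; have := bp 0 j; rewrite lexx add0r u0 => /(_ isT) ? /(_ isT) ?.
  by rewrite ler_norml; lra.
have /choice[pinf hinf] : forall i, exists l, forall t, 0 <= t -> `|p t i - l| <= W t.
  move=> i; have [|l hl] := @nested_intervals _ _ (0 : R)
      (fun t => p `|t| i - W `|t|) (fun t => p `|t| i + W `|t|).
    move=> s t; have := W0 `|s|; have := W0 `|t|.
    case: (leP `|s| `|t|) => [|/ltW] st.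
      by have := cauchy _ _ i (normr_ge0 s) st; rewrite ler_norml; lra.
    by have := cauchy _ _ i (normr_ge0 t) st; rewrite ler_norml; lra.
  exists l => t t0; have := hl t; rewrite ger0_norm// ler_norml; lra.
have binf : in_box m M pinf.
  move=> i; apply/andP; split; apply: (le_of_decay mM0) => t t0;
    have := hinf i t t0; rewrite ler_norml -/(W t); have := bp t i t0; lra.
exists pinf; split => // i; last by move=> j; exact: hinf.
have B0 : 0 <= speed_bound by exact: le_trans (normr_ge0 _) (dual_curvature_bounded (p 0) i).
have D0 : 0 <= damping by apply: mulr_ge0 => //; have := dhat_ge1 i; lra.
apply/eqP; rewrite -normr_le0.
apply: (@le_of_decay _ _ (speed_bound + 2 * damping * (M - m))) => [|t t0].
  by apply: addr_ge0 => //; apply: mulr_ge0 => //; exact: mulr_ge0.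
have k1 := flow_curvature_decay hp i t0.
have k2 : `|dual_curvature pinf i - dual_curvature (p t) i| <= 2 * damping * W t.
  apply: dual_curvature_lipschitz => // j; first exact: bp.
  by rewrite distrC; exact: hinf.
have := ler_normD (dual_curvature pinf i - dual_curvature (p t) i) (dual_curvature (p t) i).
rewrite subrK; move: k1 k2; rewrite /W; lra.
Qed.

End Box.

(** The angles at [i] are at most [pi / dhat], and there are at most [dhat] of
    them. *)
Lemma exists_low_barrier : exists2 m : R, 0 < m &
  forall p i, 0 < p i <= m -> 0 <= dual_curvature p i.
Proof.
have [[i0]|V0] := pselect (inhabited V); last first.
  by exists 1 => // p i; case: V0.
have d1 : 1 <= dhat by exact: le_trans (size_ge1 i0) (star_le i0).
have d0 : 0 < dhat by lra.
have pi0 := pi_gt0 R.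
have [m m0 hm] := ideal_angle_small kappa_gt0 (divr_gt0 pi0 d0).
exists m => // p i pim.
have : \sum_(h <- star i) ideal_angle (Th h) (p i) (p (tgt h)) <=
    \sum_(h <- star i) (pi / dhat).
  by apply: ler_sum => h _; apply: hm => //; exact: lt_le_trans (sigma_le h).
rewrite sum_const_seq.
have : (size (star i))%:R * (pi / dhat) <= dhat * (pi / dhat).
  by apply: ler_wpM2r; [rewrite divr_ge0// ltW | exact: star_le].
rewrite [dhat * _]mulrC mulfVK ?gt_eqF// /dual_curvature; lra.
Qed.

(** The neighbours are at most [M], so the angles at [i] are at least those of the
    metric that is constantly [M], at least [Th h / 2 - chat / 2] for large [M].
    The loss of [chat / 2] per half-edge is covered by the excess of the sum of the
    [Th h] over [2 * pi]. *)
Lemma exists_high_barrier (chat : R) : 0 < chat ->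
  (forall i, chat * (size (star i))%:R <= \sum_(h <- star i) Th h - 2 * pi) ->
  exists2 M0 : R, 0 < M0 & forall M, M0 <= M -> forall p i, p i = M ->
    (forall j, 0 < p j <= M) -> dual_curvature p i <= 0.
Proof.
move=> c0 hc.
have c2 : 0 < chat / 2 by rewrite divr_gt0.
have [M0 M00 hM0] := ideal_angle_diag_lower sigma_gt0 c2.
exists M0 => // M MM p i pM hp.
have M_gt0 : 0 < M by lra.
have : \sum_(h <- star i) (2^-1 * Th h - chat / 2) <=
    \sum_(h <- star i) ideal_angle (Th h) (p i) (p (tgt h)).
  apply: ler_sum => h _.
  have := hM0 _ _ (Th_itv h) (sigma_le h) MM; rewrite mulrC => /le_trans; apply.
  rewrite pM; have /andP[q0 qM] := hp (tgt h).
  by apply: le_ideal_angle => //; [exact: lt_le_trans (sigma_le h) | exact: ltW].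
rewrite sumrB sum_const_seq -mulr_sumr.
have := hc i; rewrite /dual_curvature; lra.
Qed.

(** An arbitrary positive solution [q] stays above [m] because the low barrier does
    not depend on the other coordinates, and it stays below [M + speed_bound * t]
    up to time [t]; so [flow_contraction] applies in this larger box. *)
Lemma flow_unique (m M : R) (p q : R -> V -> R) : 0 < m -> m <= M ->
  (forall p i, 0 < p i <= m -> 0 <= dual_curvature p i) ->
  (forall T, flows_on m M T p) ->
  (forall t i, 0 <= t -> 0 < q t i) ->
  (forall t i, 0 <= t -> is_derive t 1 (q ^~ i) (dual_curvature (q t) i)) ->
  q 0 = p 0 -> forall t i, 0 <= t -> q t i = p t i.
Proof.
move=> m0 mM lowK hp q0 dq e0 t i t0.
have B0 : 0 <= speed_bound by exact: le_trans (normr_ge0 _) (dual_curvature_bounded (p 0) i).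
have b0 j : m <= p 0 j <= M.
  by have [|+ _] := hp 0 0 j; rewrite ?lexx// => /(_ j).
pose M' := M + speed_bound * t.
have MM' : M <= M' by rewrite lerDl mulr_ge0.
have mM' : m <= M' by lra.
have qbox s : 0 <= s <= t -> in_box m M' (q s).
  move=> /andP[s0 st] j; apply/andP; split.
  - apply: (@barrier_below _ (q ^~ j) (fun z => dual_curvature (q z) j) m s s0).
    + by move=> z /andP[z0 _]; exact: dq.
    + by move=> z /andP[z0 _] qm; apply: lowK; rewrite q0.
    + by rewrite e0; have := b0 j; lra.
  - have : q s j - q 0 j <= speed_bound * s.
      apply: (@le_of_derive _ (fun z => q z j - q 0 j) (fun z => speed_bound * z)
        (fun z => dual_curvature (q z) j) (fun=> speed_bound) s s0).
      + move=> z /andP[z0 _]; have h := dq z j z0.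
        have -> : (fun z => q z j - q 0 j) = q ^~ j - cst (q 0 j) by [].
        by apply: is_derive_eq; rewrite subr0.
      + move=> z _; have -> : (fun z => speed_bound * z) = speed_bound *: id by [].
        by apply: is_derive_eq; rewrite /GRing.scale/= mulr1.
      + by move=> z _; apply: le_trans (dual_curvature_bounded _ _); exact: ler_norm.
      + by rewrite subrr mulr0.
    have : speed_bound * s <= speed_bound * t by rewrite ler_wpM2l.
    by rewrite e0 /M'; have := b0 j; lra.
have hq' : flows_on m M' t q.
  by move=> s j st; split; [exact: qbox | apply: dq; case/andP: st].
have hp' : flows_on m M' t p.
  move=> s j st; have [h1 h2] := hp t s j st; split=> // k.
  by have := h1 k; lra.
have tt : 0 <= t <= t by rewrite t0 lexx.
have := @flow_contraction m M' m0 mM' t 0 q p hq' hp' _ t i tt.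
rewrite mul0r normr_le0 subr_eq0 => h; apply/eqP; apply: h => j.
by rewrite e0 subrr normr0.
Qed.

End DualFlow.

(** * From radii to dual radii *)

Section Translation.
Context {R : realType}.

Lemma sin_ge_itv (delta theta : R) : 0 < delta -> delta < theta < pi - delta ->
  sin delta <= sin theta.
Proof.
move=> d0 hd.
pose a := (theta + delta) / 2; pose b := (theta - delta) / 2.
have -> : theta = a + b by rewrite /a /b; field.
have {1}-> : delta = a - b by rewrite /a /b; field.
have ca : 0 < cos a by apply: cos_gt0_pihalf; rewrite /a; lra.
have sb : 0 < sin b by apply: sin_gt0_pihalf; rewrite /b; lra.
rewrite sinB (sinD a b); have := mulr_gt0 ca sb; lra.
Qed.

Lemma cos_ge_itv (delta theta : R) : 0 < delta -> delta < theta < pi - delta ->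
  - cos delta <= cos theta.
Proof.
move=> d0 hd.
have <- : cos (pi - delta) = - cos delta by rewrite cosB cospi sinpi; ring.
by apply: ltW; rewrite ltr_cos ?in_itv/=; lra.
Qed.

(** The derivative is at most [1 / sinh m] in absolute value. *)
Lemma dual_radius_lipschitz (m x y : R) : 0 < m -> m <= x -> m <= y ->
  `|dual_radius x - dual_radius y| <= `|x - y| / sinh m.
Proof.
move=> m0; wlog xy : x y / x <= y => [hw mx my|mx my].
  case: (leP x y) => [|/ltW] xy; first exact: hw.
  by rewrite distrC (distrC x); exact: hw.
have [||c] := @MVT_segment _ dual_radius (fun z => - (sinh z)^-1) x y xy.
- by move=> z; rewrite in_itv/= => hz; apply: is_derive_dual_radius; lra.
- apply: derivable_within_continuous => z; rewrite in_itv/= => hz.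
  have z0 : 0 < z by lra.
  by have [] := is_derive_dual_radius z0.
rewrite in_itv/= => hc e.
have mc : m <= c by lra.
have sm := sinh_gt0 m0.
have sc : 0 < sinh c by apply: lt_le_trans (ler_sinh mc).
rewrite distrC e normrM (distrC x) mulrC normrN (gtr0_norm (x := _^-1)) ?invr_gt0//.
by apply: ler_wpM2l => //; rewrite lef_pV2 ?posrE//; exact: ler_sinh.
Qed.

Variables (S : topologicalType) (V E F : choiceType).
Variables (D : cellular_decomposition R S V E F) (Theta : E -> R).

(** A vertex with an infinite star has degree [0] by the definition of [degree], and
    a quotient by [0] is [0]; so a positive mean character makes stars finite and
    nonempty. *)
Lemma positive_mean_character (c : R) i : 0 < c -> c <= mean_character D Theta i ->
  [/\ finite_set (star D i), (0 < degree D i)%N &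
    c * (degree D i)%:R <= \sum_(h <- fset_set (star D i)) Theta h.1 - 2 * pi].
Proof.
move=> c0 hc.
have d0 : (0 < degree D i)%N.
  rewrite lt0n; apply/negP => /eqP d0.
  by move: hc; rewrite /mean_character d0 invr0 mulr0; lra.
have fin : finite_set (star D i).
  apply: contrapT => inf; move: d0.
  by rewrite /degree /fset_set; case: pselect => // ?; rewrite cardfs0.
split => //.
move: hc; rewrite /mean_character fsbig_finite//= ler_pdivlMr// ltr0n.
by [].
Qed.

Definition star_seq i : seq (E * bool) := fset_set (star D i).

Lemma curvature_dual (r : V -> R) i : (forall j, finite_set (star D j)) ->
  (forall e, 0 < sin (Theta e)) -> (forall j, 0 < r j) ->
  curvature D Theta r i = dual_curvature star_seq (half_edge_target D)
    (fun h => Theta h.1) (dual_radius \o r) i.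
Proof.
move=> fin s0 r0; rewrite /curvature /dual_curvature fsbig_finite//=.
by congr (_ - 2 * _); apply: eq_bigr => h _; exact: inner_angleE.
Qed.

End Translation.

Theorem theorem1p11 (R : realType) (S : topologicalType) (V E F : choiceType)
    (D : cellular_decomposition R S V E F) (Theta : E -> R)
    (delta chat dhat rhat1 rhat2 : R) (r0 : V -> R) :
  surface R S ->
  ~ compact [set: S] ->
  infinite_set [set: V] ->
  connected_skeleton D ->
  0 < delta ->
  (forall e, delta < Theta e < pi - delta) ->
  conditionC1 D Theta ->
  0 < chat ->
  0 < dhat ->
  (forall i, chat <= mean_character D Theta i) ->
  (forall i, (degree D i)%:R <= dhat) ->
  0 < rhat1 ->
  0 < rhat2 ->
  (forall i, rhat1 <= r0 i <= rhat2) ->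
  exists r : R -> V -> R,
    [/\ ricci_flow D Theta r0 r,
        forall r', ricci_flow D Theta r0 r' ->
          forall t i, 0 <= t -> r' t i = r t i
      & converges_exponentially D Theta r].
Proof.
move=> _ _ infV _ delta0 hTheta _ chat0 _ hchat hdhat rhat10 rhat20 hr0.
have hstar i := positive_mean_character chat0 (hchat i).
have fin i : finite_set (star D i) by have [] := hstar i.
have star0 i : (0 < size (star_seq D i))%N by have [] := hstar i.
have hsum i : chat * (size (star_seq D i))%:R <=
    \sum_(h <- star_seq D i) Theta h.1 - 2 * pi by have [] := hstar i.
have [i0 _] := infinite_setN0 infV.
have delta_lt : delta < pi / 2.
  have : star_seq D i0 != [::] by rewrite -size_eq0 -lt0n.
  by case: (star_seq D i0) => // h _ _; have := hTheta h.1; lra.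
pose sigma := sin delta; pose kappa : R := 1 - cos delta.
have sigma0 : 0 < sigma by apply: sin_gt0_pihalf; rewrite delta0.
have kappa0 : 0 < kappa.
  rewrite subr_gt0 -cos0 ltr_cos ?in_itv//=; have := pi_gt0 R; lra.
have sigma_le (h : E * bool) : sigma <= sin (Theta h.1) by exact: sin_ge_itv.
have kappa_le (h : E * bool) : kappa <= 1 + cos (Theta h.1).
  by have := cos_ge_itv delta0 (hTheta h.1); rewrite /kappa; lra.
have sinT e : 0 < sin (Theta e) by exact: (lt_le_trans sigma0 (sigma_le (e, true))).
have T_itv (h : E * bool) : 0 < Theta h.1 < pi by have := hTheta h.1; lra.
pose tgt := half_edge_target D; pose Th (h : E * bool) := Theta h.1.
have [m0 m00 low0] := exists_low_barrier tgt sigma0 kappa0 sigma_le kappa_le star0 hdhat.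
have [M0 M00 high0] := exists_high_barrier tgt sigma0 T_itv sigma_le chat0 hsum.
(* dual_radius reverses the order, so rhat2 limits m and rhat1 limits M *)
pose m := Num.min m0 (dual_radius rhat2); pose M := Num.max M0 (dual_radius rhat1).
have r00 i : 0 < r0 i by have := hr0 i; lra.
have m_gt0 : 0 < m by rewrite lt_min m00 dual_radius_gt0.
have box0 : in_box m M (dual_radius \o r0).
  move=> i; have /andP[r1 r2] := hr0 i; apply/andP; split.
    apply: (@le_trans _ _ (dual_radius rhat2)); last exact: ler_dual_radius.
    by rewrite ge_min lexx orbT.
  apply: (@le_trans _ _ (dual_radius rhat1)); first exact: ler_dual_radius.
  by rewrite le_max lexx orbT.
have mM : m <= M by have := box0 i0; lra.
have low p i : 0 < p i <= m -> 0 <= dual_curvature (star_seq D) tgt Th p i.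
  move=> pm; apply: low0; have : m <= m0 by rewrite ge_min lexx.
  lra.
have high p i : p i = M -> (forall j, 0 < p j <= M) ->
    dual_curvature (star_seq D) tgt Th p i <= 0.
  by apply: high0; rewrite le_max lexx.
have [p [p0 hp]] := flow_exists sigma0 kappa0 sigma_le kappa_le star0 hdhat m_gt0 mM
  low high box0.
have pbox (t : R) i : 0 <= t -> m <= p t i <= M.
  by move=> t0; have [|+ _] := hp t t i; rewrite ?t0 ?lexx// => /(_ i).
have pderiv (t : R) i : 0 <= t ->
    is_derive t 1 (p ^~ i) (dual_curvature (star_seq D) tgt Th (p t) i).
  by move=> t0; have [|_] := hp t t i; rewrite ?t0 ?lexx.
have pgt0 (t : R) i : 0 <= t -> 0 < p t i by move=> /pbox -/(_ i); lra.
pose r (t : R) i := dual_radius (p t i).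
have rgt0 t i : 0 <= t -> 0 < r t i by move=> t0; exact/dual_radius_gt0/pgt0.
have rK (t : R) : 0 <= t -> dual_radius \o r t = p t.
  by move=> t0; apply/funext => i; rewrite /= dual_radiusK// pgt0.
have curv t i : 0 <= t ->
    curvature D Theta (r t) i = dual_curvature (star_seq D) tgt Th (p t) i.
  by move=> t0; rewrite curvature_dual// ?rK// => j; exact: rgt0.
exists r; split.
- split=> [t t0 i|i|i t t0].
  + exact: rgt0.
  + by rewrite /r p0 /= dual_radiusK.
  + apply: is_derive_half_line; rewrite curv//.
    have := @is_derive1_comp _ (@dual_radius R) (p ^~ i) t _ _
      (is_derive_dual_radius (pgt0 t i t0)) (pderiv t i t0).
    rewrite sinh_dual_radius; last exact: pgt0.
    by rewrite mulrC mulrN -mulNr.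
- move=> r' [r'0 r'00 r'D].
  (* r' is replaced by functions g i that are differentiable at 0 too *)
  have /choice[g hg] : forall i, exists g : R -> R, (forall t, 0 <= t -> g t = r' t i) /\
      forall t : R, 0 <= t -> is_derive t 1 g (- curvature D Theta (r' t) i * sinh (r' t i)).
    by move=> i; have [g h1 h2] := half_line_extension (r'D i); exists g.
  pose q (t : R) i := dual_radius (g i t).
  have qE t : 0 <= t -> q t = dual_radius \o r' t.
    by move=> t0; apply/funext => i /=; rewrite /q (hg i).1.
  have dq (t : R) i : 0 <= t ->
      is_derive t 1 (q ^~ i) (dual_curvature (star_seq D) tgt Th (q t) i).
    move=> t0; have gt : 0 < g i t by rewrite (hg i).1//; exact: r'0.
    have := @is_derive1_comp _ (@dual_radius R) (g i) t _ _
      (is_derive_dual_radius gt) ((hg i).2 t t0).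
    rewrite (hg i).1// qE// -curvature_dual//; last by move=> j; exact: r'0.
    move=> h; apply: (@is_derive_eq _ _ _ _ _ _ _ _ h).
    by field; rewrite gt_eqF// sinh_gt0//; exact: r'0.
  have q0 t i : 0 <= t -> 0 < q t i.
    by move=> t0; rewrite qE//=; apply: dual_radius_gt0; exact: r'0.
  have q00 : q 0 = p 0.
    by rewrite qE// p0; apply/funext => i /=; rewrite r'00.
  move=> t i t0.
  have := flow_unique sigma0 kappa0 sigma_le kappa_le star0 hdhat m_gt0 mM low hp
    q0 dq q00 i t0.
  by rewrite qE//= /r => <-; rewrite dual_radiusK//; exact: r'0.
- have [pinf [binf Kinf cinf]] := flow_converges sigma0 kappa0 sigma_le kappa_le star0 hdhat
    m_gt0 mM hp.
  have decay := flow_curvature_decay sigma0 kappa0 sigma_le kappa_le star0 hdhat m_gt0 mM hp.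
  have pinf0 i : 0 < pinf i by have := binf i; lra.
  have sm := sinh_gt0 m_gt0.
  have W0 : 0 <= (M - m) / sinh m by rewrite divr_ge0 ?subr_ge0// ltW.
  have B0 : 0 <= speed_bound dhat.
    exact: le_trans (normr_ge0 _)
      (dual_curvature_bounded (star := star_seq D) tgt Th hdhat (p 0) i0).
  (* the two summands bound the radii and the curvatures; 1 makes the constant
     positive *)
  exists ((M - m) / sinh m + speed_bound dhat + 1), (decay_rate sigma kappa M),
    (dual_radius \o pinf); split.
  + lra.
  + exact: decay_rate_gt0.
  + split=> i; first exact: dual_radius_gt0.
    rewrite curvature_dual//; last by move=> j; exact: dual_radius_gt0.
    rewrite -[RHS](Kinf i); congr (dual_curvature _ _ _ _ _).
    by apply/funext => j /=; rewrite dual_radiusK.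
  + move=> i t t0.
    set e := expR _.
    have e0 : 0 <= e by exact: expR_ge0.
    split.
    * have h1 := cinf t i t0.
      have /andP[h2 _] := pbox t i t0; have /andP[h3 _] := binf i.
      apply: (le_trans (dual_radius_lipschitz m_gt0 h2 h3)).
      rewrite ler_pdivrMr//; apply: (le_trans h1); rewrite -/e.
      have -> : ((M - m) / sinh m + speed_bound dhat + 1) * e * sinh m =
          (M - m) * e + (speed_bound dhat + 1) * e * sinh m.
        by field; rewrite gt_eqF.
      by rewrite lerDl; apply: mulr_ge0; [apply: mulr_ge0 => //; lra | exact: ltW].
    * rewrite curv//; apply: (le_trans (decay t i t0)); rewrite -/e.
      by rewrite ler_wpM2r//; lra.
Qed.
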